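(* Let $\varphi$ be an Orlicz function and let $w:I\to(0,\infty)$ be a decreasing weight on $I=(0,a)$, $0<a\le\infty$, with $W(t)=\int_0^t w\,dm<\infty$ for all $t\in I$. For $f\in Q_{L_\varphi,w}$, the modular $\mathrm Q(f)$ is expressed in terms of the level function $f^0$ of $f$ with respect to $w$ by $$\mathrm Q(f)=\mathrm M(f^0)=\int_I\varphi\left(\frac{f^0}{w}\right)w\,dm.$$
   Context: $m$ is Lebesgue measure; functions are identified when equal a.e.; ''decreasing'' means non-increasing. $L^0(I)$ is the space of real Lebesgue measurable functions on $I$. $f^*$ is the decreasing rearrangement of $f\in L^0(I)$ with respect to $m$. $f\prec g$ means $\int_0^x f^*\,dm\le\int_0^x g^*\,dm$ for all $x\in I$. An Orlicz function is a convex $\varphi:[0,\infty)\to[0,\infty)$ with $\varphi(0)=0$ and $\varphi>0$ on $(0,\infty)$. For $f\in L^0(I)$, $\mathrm M(f)=\int_I\varphi\left(\frac{f^*}{w}\right)w\,dm\in[0,\infty]$. $M_{L_\varphi,w}$ is the class of $f\in L^0(I)$ with $\mathrm M(\lambda f)<\infty$ for some $\lambda>0$. $Q_{L_\varphi,w}$ is the set of $f\in L^0(I)$ with $f\prec g$ for some $g\in M_{L_\varphi,w}$. For $f\in L^0(I)$, $\mathrm Q(f)=\inf\{\mathrm M(g): f\prec g,\ g\in M_{L_\varphi,w}\}$. Level function (Halperin). For $f\in L^0(I)$ with $f^*$ finite and integrable on the finite intervals $(0,t)$, $t\in I$, and $0\le\alpha<\beta<\infty$, $(\alpha,\beta)\subset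 I$, put $W(\alpha,\beta)=\int_\alpha^\beta w\,dm$, $F(\alpha,\beta)=\int_\alpha^\beta f^*\,dm$, $R(\alpha,\beta)=F(\alpha,\beta)/W(\alpha,\beta)$, and, if $a=\infty$, $R(\alpha,\infty)=\limsup_{t\to\infty}R(\alpha,t)$. An interval $(\alpha,\beta)\subset I$ ($\beta\le\infty$) is a level interval if $R(\alpha,\beta)>0$ and $R(\alpha,t)\le R(\alpha,\beta)$ for each $t\in(\alpha,\beta)$; it is a maximal level interval if not contained in a larger level interval. Maximal level intervals are pairwise disjoint, hence at most countably many. The level function is $f^0(t)=R(\alpha,\beta)w(t)$ if $t$ belongs to a maximal level interval $(\alpha,\beta)$, and $f^0(t)=f^*(t)$ otherwise. *)

(* Defs.v *)
From HB Require Import structures.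
From mathcomp Require Import all_boot all_order all_algebra.
From mathcomp Require Import all_classical all_reals all_analysis.

Set Implicit Arguments.
Unset Strict Implicit.
Unset Printing Implicit Defensive.

Import Order.TTheory GRing.Theory Num.Theory.
Import numFieldNormedType.Exports.

Local Open Scope classical_set_scope.
Local Open Scope ring_scope.
Local Open Scope ereal_scope.

Section Defs.
Context {R : realType}.

(* The real line with the sigma-algebra of Lebesgue (not only Borel)
   measurable sets, i.e. the domain of [completed_lebesgue_measure]. *)
Definition lebesgueTypeR : measurableType _ :=
  caratheodory_type ((wlength (@idfun R))^*)%mu.

Definition orlicz (phi : R -> R) : Prop :=
  [/\ convex_function ([set` `[0%R, +oo[] : set R^o) phi,
      phi 0%R = 0%R &
      forall x : R, (0 < x)%R -> (0 < phi x)%R].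

(* The open interval (alpha, beta), where beta may be infinite;
   in particular I = (0, a) is [oitv 0 a]. *)
Definition oitv (alpha : R) (beta : \bar R) : set R :=
  [set t | (alpha < t)%R /\ t%:E < beta].

Definition weight (a : \bar R) (w : R -> R) : Prop :=
  [/\ forall t, oitv 0 a t -> (0 < w t)%R,
      forall s t, oitv 0 a s -> oitv 0 a t -> (s <= t)%R -> (w t <= w s)%R &
      forall t, oitv 0 a t ->
        \int[lebesgue_measure]_(x in oitv 0 t%:E) (w x)%:E < +oo].

(* Functions on I are represented by functions on the whole line, whose values
   outside I play no role; two functions equal a.e. on I have the same
   rearrangement, through which alone functions enter below. *)
Definition L0 (a : \bar R) (f : R -> R) : Prop :=
  measurable_fun (oitv 0 a : set lebesgueTypeR) (f : lebesgueTypeR -> R).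

(* Rearrangements are defined for extended-real functions, so that they apply to
   level functions, which may be infinite for f outside Q_{L_phi, w}. *)
Definition distr (a : \bar R) (f : R -> \bar R) (s : R) : \bar R :=
  completed_lebesgue_measure [set x : R | oitv 0 a x /\ s%:E < `|f x|].

Definition rearr (a : \bar R) (f : R -> \bar R) (t : R) : \bar R :=
  ereal_inf [set s%:E | s in [set s : R | (0 <= s)%R /\ distr a f s <= t%:E]].

(* In this and the other integrals the integrand is Borel measurable, so that
   [lebesgue_measure] and its completion give the same value. *)
Definition prec (a : \bar R) (f g : R -> R) : Prop :=
  forall x, oitv 0 a x ->
    \int[lebesgue_measure]_(t in oitv 0 x%:E) rearr a (EFin \o f) t <=
    \int[lebesgue_measure]_(t in oitv 0 x%:E) rearr a (EFin \o g) t.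

(* The integral over I of phi(h / w) w; [er_map] sets phi(+oo) = +oo. *)
Definition wint (phi : R -> R) (a : \bar R) (w : R -> R) (h : R -> \bar R) :
    \bar R :=
  \int[lebesgue_measure]_(t in oitv 0 a)
    (er_map phi (h t * ((w t)^-1)%:E) * (w t)%:E).

Definition Mmod (phi : R -> R) (a : \bar R) (w : R -> R) (f : R -> \bar R) :
    \bar R :=
  wint phi a w (rearr a f).

Definition Mclass (phi : R -> R) (a : \bar R) (w : R -> R) : set (R -> R) :=
  [set f | L0 a f /\
    exists lambda : R, (0 < lambda)%R /\
      Mmod phi a w (fun x => (lambda * f x)%:E) < +oo].

Definition Qclass (phi : R -> R) (a : \bar R) (w : R -> R) : set (R -> R) :=
  [set f | L0 a f /\ exists g, Mclass phi a w g /\ prec a f g].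

Definition Qmod (phi : R -> R) (a : \bar R) (w : R -> R) (f : R -> R) : \bar R :=
  ereal_inf [set Mmod phi a w (EFin \o g)
            | g in [set g | prec a f g /\ Mclass phi a w g]].

Definition Wint (w : R -> R) (alpha : R) (beta : \bar R) : \bar R :=
  \int[lebesgue_measure]_(t in oitv alpha beta) (w t)%:E.

Definition Fint (a : \bar R) (f : R -> R) (alpha : R) (beta : \bar R) : \bar R :=
  \int[lebesgue_measure]_(t in oitv alpha beta) rearr a (EFin \o f) t.

(* For finite beta, W(alpha, beta) is finite and positive whenever
   0 <= alpha < beta <= a. *)
Definition ratio_fin (a : \bar R) (w f : R -> R) (alpha beta : R) : \bar R :=
  Fint a f alpha beta%:E * ((fine (Wint w alpha beta%:E))^-1)%:E.

Definition ratio (a : \bar R) (w f : R -> R) (alpha : R) (beta : \bar R) :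
    \bar R :=
  if beta is b%:E then ratio_fin a w f alpha b
  else limf_esup (ratio_fin a w f alpha) (pinfty_nbhs R).

Definition level_interval (a : \bar R) (w f : R -> R)
    (alpha : R) (beta : \bar R) : Prop :=
  [/\ (0 <= alpha)%R, alpha%:E < beta, oitv alpha beta `<=` oitv 0 a,
      0 < ratio a w f alpha beta &
      forall t, oitv alpha beta t ->
        ratio a w f alpha t%:E <= ratio a w f alpha beta].

Definition maximal_level_interval (a : \bar R) (w f : R -> R)
    (alpha : R) (beta : \bar R) : Prop :=
  level_interval a w f alpha beta /\
  forall (alpha' : R) (beta' : \bar R), level_interval a w f alpha' beta' ->
    oitv alpha beta `<=` oitv alpha' beta' ->
    oitv alpha' beta' = oitv alpha beta.

(* Maximal level intervals are pairwise disjoint, so the interval selected by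
   [cid] is the only one that contains t. *)
Definition level_function (a : \bar R) (w f : R -> R) (t : R) : \bar R :=
  if pselect (exists p : R * \bar R,
      maximal_level_interval a w f p.1 p.2 /\ oitv p.1 p.2 t) is left h
  then let p := projT1 (cid h) in ratio a w f p.1 p.2 * (w t)%:E
  else rearr a (EFin \o f) t.

End Defs.

(* Main.v *)
Require Import Defs.
From HB Require Import structures.
From mathcomp Require Import all_boot all_order all_algebra.
From mathcomp Require Import all_classical all_reals all_analysis.
From mathcomp Require Import measurable_realfun.
From mathcomp Require Import ring lra.

(* Write F and W for the primitives of f* and w, and plot F against W. Maximal
   level intervals are the maximal segments on which the least concave majorant
   of this graph is affine, so f0 / w is almost everywhere the slope of the
   majorant. That slope has the min-max formula
     k(t) = inf_(x < t) sup_(y > t) (F y - F x) / (W y - W x),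
   which is visibly non-increasing; k = r on a maximal level interval of slope r,
   and k = f* / w at the other points where f* and w are continuous.
   With K the primitive of k w, one gets K = F off the level intervals and
   K >= F everywhere, so that f is dominated by k w. For the lower bound on Q(f),
   phi is a limit from below of positive combinations of hinges v |-> (v - s)^+,
   and for a hinge
     int (k - s)^+ w = sup (K - s W on {k > s}) <= sup (F - s W)
                     <= sup (G - s W) <= int (g* / w - s)^+ w
   whenever f is dominated by g, G being the primitive of g*. *)

Set Implicit Arguments.
Unset Strict Implicit.
Unset Printing Implicit Defensive.

Import Order.TTheory GRing.Theory Num.Theory.
Import numFieldNormedType.Exports.

Local Open Scope classical_set_scope.
Local Open Scope ring_scope.

(** The level function is defined by cases, so neither its monotonicity nor its measurability can be
    read off. Both come from the min-max formula, which makes sense at every point of I and agrees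
    with f0 / w off the countably many jumps of f* and w. As a product of two nonnegative
    non-increasing functions, k w is its own rearrangement off a countable set, which is why M(f0)
    is a plain integral. Membership in Q enters through an affine bound F <= A + B W, inherited from
    the dominating function: it bounds the slopes from a point to all later points that stay away
    from it, so that R(alpha, +oo) is finite. The infimum in Q(f) is attained at k w when M(f0) is
    finite; otherwise the lower bound alone gives Q(f) = +oo. Hinges suit the relation of
    domination, which compares primitives only: since k is non-increasing, {k > s} is an initial
    interval, and the integral of a hinge is a value of a primitive. *)

(** * Level intervals and slopes of the concave majorant, for an abstract pair F, W *)

Section Concave.
Context {R : realType} (a : \bar R) (F W : R -> R) (A B : R).

(** The affine bound [gp_le] is the trace of membership in Q; it makes suprema of slopes finite.
    Monotonicity reaches [y = a] because a level interval may end at a finite [a]. *)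
Record growth_pair : Prop := GrowthPair {
  gp_contF : continuous F;
  gp_contW : continuous W;
  gp_homoF : forall x y : R, 0 <= x -> x <= y -> (y%:E <= a)%E -> F x <= F y;
  gp_incW : forall x y : R, 0 <= x -> x < y -> (y%:E <= a)%E -> W x < W y;
  gp_W0 : W 0 = 0;
  gp_F0 : F 0 = 0;
  gp_A : 0 <= A;
  gp_B : 0 <= B;
  gp_le : forall y, oitv 0 a y -> F y <= A + B * W y }.

Hypothesis FW : growth_pair.
Let cF := gp_contF FW.
Let cW := gp_contW FW.
Let F_nd := gp_homoF FW.
Let W_inc := gp_incW FW.
Let W0 := gp_W0 FW.
Let F0 := gp_F0 FW.
Let A_ge0 := gp_A FW.
Let B_ge0 := gp_B FW.
Let F_le := gp_le FW.

(* (al, be) is a level interval with slope r. The last clause says that the slopes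
   from al have limit superior at least r at be, which covers both the condition
   R(al, be) = r for finite be and the definition of R(al, +oo). *)
Definition lev_itv (al : R) (be : \bar R) (r : R) : Prop :=
  [/\ 0 <= al, (al%:E < be)%E, (be <= a)%E & 0 < r] /\
  (forall t, oitv al be t -> F t - F al <= r * (W t - W al)) /\
  (forall e t : R, 0 < e -> oitv al be t ->
     exists2 y, oitv t be y & (r - e) * (W y - W al) <= F y - F al).

Definition max_lev (al : R) (be : \bar R) (r : R) : Prop :=
  lev_itv al be r /\ forall al' be' r', lev_itv al' be' r' ->
    oitv al be `<=` oitv al' be' -> oitv al' be' = oitv al be.

(* [majslope t] is inf_(0 <= x < t) sup_(t < y < a) of the slope of (x, y); the
   inner supremum is replaced by its upper bounds. *)
Definition majset (t : R) : set R := [set c | 0 <= c /\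
  exists2 x, 0 <= x < t & forall y, oitv t a y -> F y - F x <= c * (W y - W x)].

Definition majslope (t : R) : R := inf (majset t).

(* Fb and Wb are the left limits of F and W at be. *)
Definition end_values (be : \bar R) (Fb Wb : R) : Prop :=
  (forall y, 0 <= y -> (y%:E < be)%E -> F y <= Fb /\ W y <= Wb) /\
  (forall e t : R, 0 < e -> 0 <= t -> (t%:E < be)%E ->
     exists2 y, oitv t be y & Fb - e <= F y /\ Wb - e <= W y).

Let W_le (x y : R) : 0 <= x -> x <= y -> (y%:E <= a)%E -> W x <= W y.
Proof.
by move=> x0; rewrite le_eqVlt => /predU1P[->//|xy] ya; exact/ltW/W_inc.
Qed.

Lemma between_oitv (t : R) (be : \bar R) : (t%:E < be)%E ->
  exists y, oitv t be y.
Proof.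
case: be => [b||]//=.
- by rewrite lte_fin => tb; exists ((t + b) / 2); split; [lra|rewrite lte_fin; lra].
- by move=> _; exists (t + 1); split; [lra|rewrite ltry].
Qed.

Lemma continuous_dist (G : R -> R) (x e : R) : continuous G -> 0 < e ->
  exists2 d, 0 < d & forall y, `|x - y| < d -> `|G x - G y| < e.
Proof.
move=> cG e0; have /cvgrPdist_lt/(_ _ e0) := cG x.
by move=> /nbhs_ballP[d /= d0 H]; exists d => // y xy; exact: H.
Qed.

Lemma end_values_fin b : 0 < b -> (b%:E <= a)%E -> end_values b%:E (F b) (W b).
Proof.
move=> b0 ba; split.
- by move=> y y0; rewrite lte_fin => yb; split; [apply: F_nd|apply: W_le] => //;
    exact: ltW.
- move=> e t e0 t0; rewrite lte_fin => tb.
  have [d1 d10 H1] := continuous_dist b cF e0.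
  have [d2 d20 H2] := continuous_dist b cW e0.
  pose d := Num.min (Num.min d1 d2) (b - t).
  have d0 : 0 < d by rewrite !lt_min d10 d20; lra.
  have dd1 : d <= d1 by rewrite !ge_min lexx.
  have dd2 : d <= d2 by rewrite !ge_min lexx orbT.
  have dbt : d <= b - t by rewrite !ge_min lexx orbT.
  have bd : `|b - (b - d / 2)| < d by rewrite opprB addrC subrK ger0_norm; lra.
  exists (b - d / 2); first by split; [lra|rewrite lte_fin; lra].
  have := H1 _ (lt_le_trans bd dd1); have := H2 _ (lt_le_trans bd dd2).
  by rewrite !ltr_norml => /andP[? ?] /andP[? ?]; split; lra.
Qed.

(** The affine bound turns a bound on [W] into one on [F]. This gives finite end values even at an
    infinite right end. *)
Lemma end_values_bounded (be : \bar R) (M : R) : (0 < be)%E -> (be <= a)%E ->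
  (forall y, 0 <= y -> (y%:E < be)%E -> W y <= M) ->
  exists Fb Wb, end_values be Fb Wb.
Proof.
move=> be0 bea WM.
pose D := [set y | 0 <= y /\ (y%:E < be)%E].
have D0 : D 0 by [].
have FM y : D y -> F y <= A + B * M.
  move=> [y0 yb]; move: y0; rewrite le_eqVlt => /predU1P[y0|y0].
    rewrite -y0 F0 addr_ge0// mulr_ge0//; apply: le_trans (WM 0 _ _) => //.
    by rewrite W0.
  apply: le_trans (F_le _) _; first by split => //; exact: lt_le_trans bea.
  by rewrite lerD2l ler_wpM2l// WM// ltW.
have hsF : has_sup (F @` D).
  by split; [exists (F 0), 0|exists (A + B * M) => _ [y Dy <-]; exact: FM].
have hsW : has_sup (W @` D).
  by split; [exists (W 0), 0|exists M => _ [y [? ?] <-]; exact: WM].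
exists (sup (F @` D)), (sup (W @` D)); split.
  move=> y y0 yb; split; apply: ub_le_sup; [exact: hsF.2| |exact: hsW.2|];
    by exists y.
move=> e t e0 t0 tb.
have [_ [y1 [y10 y1b] <-] H1] := sup_adherent e0 hsF.
have [_ [y2 [y20 y2b] <-] H2] := sup_adherent e0 hsW.
have [y] : exists y, oitv (Num.max t (Num.max y1 y2)) be y.
  by apply: between_oitv; rewrite !EFin_max !gt_max tb y1b y2b.
move=> [+ yb]; rewrite !gt_max => /and3P[ty y1y y2y].
have ya : (y%:E <= a)%E by apply: le_trans bea; exact: ltW.
exists y => //.
by split; [apply: le_trans (F_nd y10 (ltW y1y) ya)|apply: le_trans (W_le y20 (ltW y2y) ya)]; exact: ltW.
Qed.

(** Source of longer level intervals: a point [c] of maximal slope from [al] is a candidate for a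
    new right end. *)
Lemma slope_max al p q : 0 <= al -> al < p -> p <= q -> (q%:E <= a)%E ->
  exists c s, [/\ p <= c <= q, F c - F al = s * (W c - W al) &
    forall y, p <= y <= q -> F y - F al <= s * (W y - W al)].
Proof.
move=> al0 alp pq qa.
have Wp y : p <= y <= q -> 0 < W y - W al.
  move=> /andP[py yq]; rewrite subr_gt0; apply: W_inc => //; first lra.
  by apply: le_trans qa; rewrite lee_fin.
pose G y := (F y - F al) / (W y - W al).
have cG : {within `[p, q], continuous G}.
  apply: continuous_in_subspaceT => y /set_mem /=; rewrite in_itv/= => ypq.
  apply: cvgM; first by apply: cvgB; [exact: cF|exact: cvg_cst].
  apply: cvgV; first by rewrite gt_eqF// Wp.
  by apply: cvgB; [exact: cW|exact: cvg_cst].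
have [c + Hc] := EVT_max pq cG; rewrite in_itv/= => cpq.
exists c, (G c); split => //.
  by rewrite /G divfK// gt_eqF// Wp.
by move=> y ypq; rewrite -ler_pdivrMr ?Wp//; apply: Hc; rewrite in_itv.
Qed.

(** Mirror image of [slope_max], producing new left ends; the right end is given by values only, so
    it may be a limit at infinity. *)
Lemma slope_min Fb Wb p q : 0 <= p -> p <= q -> (q%:E <= a)%E -> W q < Wb ->
  exists c s, [/\ p <= c <= q, Fb - F c = s * (Wb - W c) &
    forall x, p <= x <= q -> s * (Wb - W x) <= Fb - F x].
Proof.
move=> p0 pq qa Wq.
have Wp y : p <= y <= q -> 0 < Wb - W y.
  move=> /andP[py yq]; rewrite subr_gt0; apply: le_lt_trans Wq; apply: W_le => //; lra.
pose G y := (Fb - F y) / (Wb - W y).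
have cG : {within `[p, q], continuous G}.
  apply: continuous_in_subspaceT => y /set_mem /=; rewrite in_itv/= => ypq.
  apply: cvgM; first by apply: cvgB; [exact: cvg_cst|exact: cF].
  apply: cvgV; first by rewrite gt_eqF// Wp.
  by apply: cvgB; [exact: cvg_cst|exact: cW].
have [c + Hc] := EVT_min pq cG; rewrite in_itv/= => cpq.
exists c, (G c); split => //.
  by rewrite /G divfK// gt_eqF// Wp.
by move=> y ypq; rewrite -ler_pdivlMr ?Wp//; apply: Hc; rewrite in_itv.
Qed.

Lemma lev_end al be r Fb Wb : 0 <= al -> (al%:E < be)%E -> (be <= a)%E -> 0 < r ->
  end_values be Fb Wb -> Fb - F al = r * (Wb - W al) ->
  (forall t, oitv al be t -> F t - F al <= r * (W t - W al)) -> lev_itv al be r.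
Proof.
move=> al0 albe bea r0 [ev1 ev2] E H; split => //; split => // e t e0 [alt tbe].
have ta : (t%:E <= a)%E by apply: le_trans bea; exact: ltW.
have Wt : 0 < W t - W al by rewrite subr_gt0 W_inc.
have t0 : 0 <= t by lra.
(* The tolerance is proportional to [W t - W al], so that relative to the larger [W y - W al] it
   costs at most [e] in slope. *)
have [y [ty ybe] [Fy _]] := ev2 (e * (W t - W al)) t (mulr_gt0 e0 Wt) t0 tbe.
exists y => //.
have ya : (y%:E <= a)%E by apply: le_trans bea; exact: ltW.
have [_ Wyb] := ev1 y (le_trans t0 (ltW ty)) ybe.
have Wty : W t <= W y by apply: W_le => //; exact: ltW.
have : e * (W t - W al) <= e * (W y - W al) by rewrite ler_pM2l//; lra.
have : r * (W y - W al) <= r * (Wb - W al) by rewrite ler_pM2l//; lra.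
lra.
Qed.

Lemma lev_end_eq al be r Fb Wb : lev_itv al be r -> end_values be Fb Wb ->
  Fb - F al = r * (Wb - W al).
Proof.
move=> [[al0 albe bea r0] [H1 H2]] [ev1 ev2]; apply/eqP; rewrite eq_le; apply/andP; split.
  apply/ler_addgt0Pl => e e0.
  have [y [aly ybe] [Fy _]] := ev2 e al e0 al0 albe.
  have [_ Wy] := ev1 y (le_trans al0 (ltW aly)) ybe.
  have := H1 y (conj aly ybe).
  have : r * (W y - W al) <= r * (Wb - W al) by rewrite ler_pM2l//; lra.
  lra.
apply/ler_addgt0Pl => e e0.
have [t1 [alt1 t1be]] := between_oitv albe.
have t10 : 0 <= t1 by lra.
have Wal : W al <= Wb by have [] := ev1 al al0 albe.
(* [d * r] pays for replacing [W y] by [Wb], and [d * (Wb - W al)] for the slope error in the tail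
   clause. *)
pose d := e / (r + (Wb - W al) + 1).
have d0 : 0 < d by rewrite divr_gt0//; lra.
have dE : d * (r + (Wb - W al) + 1) = e by rewrite divfK// gt_eqF//; lra.
have [t [t1t tbe] [_ Wt]] := ev2 d t1 d0 t10 t1be.
have [y [ty ybe] Fy] := H2 d t d0 (conj (lt_trans alt1 t1t) tbe).
have y0 : 0 <= y by lra.
have ya : (y%:E <= a)%E by apply: le_trans bea; exact: ltW.
have [FyFb WyWb] := ev1 y y0 ybe.
have Wty : W t <= W y by apply: W_le => //; lra.
have Waly : W al <= W y by apply: W_le => //; lra.
nra.
Qed.

(** The slope bound persists beyond [be]: otherwise the slope from [al] has on [[be, y]] a maximum
    [s > r], attained at some [c > be], and [(al, c)] is a larger level interval. *)
Lemma max_lev_right al be r y : max_lev al be r -> al < y -> (y%:E <= a)%E ->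
  F y - F al <= r * (W y - W al).
Proof.
move=> [Hl Hm] aly ya; rewrite leNgt; apply/negP => Hy.
have [[al0 albe bea r0] [H1 H2]] := Hl.
have : (be <= y%:E)%E.
  by rewrite leNgt; apply/negP => ybe; have := H1 y (conj aly ybe); lra.
case: be bea albe H1 H2 Hl Hm => [b||]//= ba; rewrite lte_fin => alb H1 H2 Hl Hm.
rewrite lee_fin => byy.
have b0 : 0 < b by lra.
have Eb := lev_end_eq Hl (end_values_fin b0 ba).
have [c [s [/andP[bc cy] Ec Hs]]] := slope_max al0 alb byy ya.
have Way : 0 < W y - W al by rewrite subr_gt0 W_inc.
have Wab : 0 < W b - W al by rewrite subr_gt0 W_inc.
have rs : r < s.
  rewrite -(ltr_pM2r Way); apply: lt_le_trans Hy _; apply: Hs; lra.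
have {}bc : b < c.
  rewrite lt_neqAle bc andbT; apply/eqP => bE; move: Ec; rewrite -bE Eb.
  by move=> /mulIf; rewrite gt_eqF// => /(_ isT); lra.
have ca : (c%:E <= a)%E by apply: le_trans ya.
have Lc : lev_itv al c%:E s.
  apply: (lev_end _ _ _ _ (end_values_fin _ ca)) => //; rewrite ?lte_fin; try lra.
  move=> t [alt]; rewrite lte_fin => tc.
  have [tb|bt] := ltP t b; last by apply: Hs; lra.
  apply: le_trans (H1 t _) _; first by split; rewrite ?lte_fin.
  rewrite ler_pM2r; first exact: ltW.
  by rewrite subr_gt0 W_inc// (le_trans _ ca)// lee_fin ltW.
have /(_ _)/esym E : oitv al b%:E `<=` oitv al c%:E -> _ := Hm _ _ _ Lc.
have : oitv al b%:E b.
  rewrite E; first by split; rewrite ?lte_fin.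
  by move=> t [? ]; rewrite lte_fin => ?; split => //; rewrite lte_fin; lra.
by case => _; rewrite lte_fin ltxx.
Qed.

(** Counterpart of [max_lev_right] on the left. A point [x] inside lies below the line of slope [r]
    from [al], which only helps. For [x < al], either [W] is unbounded and the shift from [al] to
    [x] is negligible far out, or end values exist and a failure produces a larger level interval
    with the same right end. *)
Lemma max_lev_left al be r x e t : max_lev al be r -> 0 <= x -> x < t -> 0 < e ->
  oitv al be t -> exists2 y, oitv t be y & (r - e) * (W y - W x) <= F y - F x.
Proof.
move=> [Hl Hm] x0 xt e0 [alt tbe].
have [[al0 albe bea r0] [H1 H2]] := Hl.
have ina y : (y%:E < be)%E -> (y%:E <= a)%E by move=> /ltW /le_trans; apply.
have ta := ina _ tbe.
have [alx|xal] := leP al x.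
  have p0 : 0 < W t - W x by rewrite subr_gt0 W_inc.
  have xbe : (x%:E < be)%E by apply: lt_trans tbe; rewrite lte_fin.
  have D0 : 0 <= W x - W al by rewrite subr_ge0; apply: W_le => //; exact: ina.
  have Fx : F x - F al <= r * (W x - W al).
    move: alx; rewrite le_eqVlt => /predU1P[->|alx]; first by rewrite !subrr mulr0.
    exact: H1.
  (* With this scaling [e' * (W y - W al) <= e * (W y - W x)] for all [y >= t], with equality at
     [t]. *)
  pose e' := e * (W t - W x) / (W t - W al).
  have e'0 : 0 < e' by rewrite divr_gt0 ?mulr_gt0//; lra.
  have e'E : e' * (W t - W al) = e * (W t - W x) by rewrite divfK// gt_eqF//; lra.
  have [y [ty ybe] Hy] := H2 e' t e'0 (conj alt tbe).
  have Wty : W t <= W y by apply: W_le; [lra|exact: ltW|exact: ina].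
  exists y => //.
  have e'e : e' <= e by rewrite ler_pdivrMr; [rewrite ler_pM2l//; lra|lra].
  have : e' * (W y - W t) <= e * (W y - W t) by rewrite ler_wpM2r//; lra.
  nra.
have xa : (x%:E <= a)%E by apply: le_trans ta; rewrite lee_fin ltW.
have ala : (al%:E <= a)%E by apply: ina.
have Wxal : W x < W al by apply: W_inc.
have Fxal : F x <= F al by apply: F_nd => //; exact: ltW.
have [[M WM]|Wub] := pselect (exists M, forall y, 0 <= y -> (y%:E < be)%E -> W y <= M); last first.
  (* Once [W y] exceeds [M], half of [e] absorbs [r * (W al - W x)], the cost of moving the left end
     from [al] to [x]. *)
  pose M := W al + 2 / e * (r * (W al - W x)).
  have [t1 [t10 t1be] Mt1] : exists2 t1, 0 <= t1 /\ (t1%:E < be)%E & M < W t1.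
    apply: contrapT => H; apply: Wub; exists M => y y0 yb.
    by rewrite leNgt; apply/negP => My; apply: H; exists y.
  have e20 : 0 < e / 2 by lra.
  have tt1be : oitv al be (Num.max t t1).
    by split; rewrite ?EFin_max ?lt_max ?alt// gt_max tbe t1be.
  have [y [+ ybe] Hy] := H2 _ _ e20 tt1be; rewrite gt_max => /andP[ty t1y].
  exists y => //.
  have : W t1 <= W y by apply: W_le; [lra|exact: ltW|exact: ina].
  have EM : e / 2 * (M - W al) = r * (W al - W x).
    by rewrite /M; field; rewrite gt_eqF.
  move=> Wt1y.
  have : e / 2 * (M - W al) <= e / 2 * (W y - W al) by rewrite ler_pM2l//; lra.
  have : 0 <= e * (W al - W x) by rewrite mulr_ge0//; lra.
  lra.
have be0 : (0 < be)%E by apply: le_lt_trans albe; rewrite lee_fin.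
have [Fb [Wb ev]] := end_values_bounded be0 bea WM.
have E := lev_end_eq Hl ev.
apply: contrapT => Hn.
have t0 : 0 <= t by lra.
have Wtb : W t <= Wb by have [] := ev.1 t t0 tbe.
have Walt : W al < W t by apply: W_inc.
(* The failure leaves a gap of [e] in slope at every [y] past [t], so the inequality stays strict in
   the limit. *)
have Hx : Fb - F x < r * (Wb - W x).
  have eta0 : 0 < e / 2 * (W t - W x) by rewrite mulr_gt0//; lra.
  have [y [ty ybe] [Fy _]] := ev.2 _ _ eta0 t0 tbe.
  have : F y - F x < (r - e) * (W y - W x).
    by rewrite ltNge; apply/negP => Hy; apply: Hn; exists y.
  have Wty : W t <= W y by apply: W_le; [lra|exact: ltW|exact: ina].
  have [_ Wyb] := ev.1 y (le_trans t0 (ltW ty)) ybe.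
  have : r * (W y - W x) <= r * (Wb - W x) by rewrite ler_pM2l//; lra.
  have : e * (W t - W x) <= e * (W y - W x) by rewrite ler_pM2l//; lra.
  lra.
have Walb : W al < Wb by lra.
(* The start of least slope towards the end lies strictly left of [al], since the slope from [al] is
   [r]; it makes [(c, be)] a level interval. *)
have [c [s [/andP[xc cal] Ec Hs]]] := slope_min Fb x0 (ltW xal) ala Walb.
have sr : s < r.
  have Wxb : 0 < Wb - W x by lra.
  rewrite -(ltr_pM2r Wxb); apply: le_lt_trans Hx; apply: Hs; lra.
have {}cal : c < al.
  rewrite lt_neqAle cal andbT; apply/eqP => cE; move: Ec; rewrite cE E.
  by move=> /mulIf; rewrite gt_eqF//; [move=> /(_ isT); lra|lra].
have c0 : 0 <= c by lra.
have Wcal : W c < W al by apply: W_inc.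
have cbe : (c%:E < be)%E by apply: lt_trans albe; rewrite lte_fin.
have Lc : lev_itv c be s.
  apply: (lev_end c0 cbe bea _ ev Ec).
    have : F c <= F al by apply: F_nd => //; exact: ltW.
    have : 0 < r * (Wb - W al) by rewrite mulr_gt0//; lra.
    rewrite -E => ? ?; have : 0 < s * (Wb - W c) by lra.
    by rewrite pmulr_lgt0//; lra.
  move=> z [cz zbe].
  have [zal|alz] := leP z al.
    have : s * (Wb - W z) <= Fb - F z by apply: Hs; lra.
    lra.
  have := H1 z (conj alz zbe).
  have [_ Wz] := ev.1 z (le_trans c0 (ltW cz)) zbe.
  have : s * (Wb - W z) <= r * (Wb - W z) by rewrite ler_wpM2r//; lra.
  lra.
have /(_ _)/esym Eq : oitv al be `<=` oitv c be -> _ := Hm _ _ _ Lc.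
have : oitv al be al.
  rewrite Eq; first by split.
  by move=> z [? ?]; split => //; lra.
by case; rewrite ltxx.
Qed.

(** [max_lev_right] says that [r] is admissible with [x = al], and [max_lev_left] that no smaller
    value is, whatever [x]. *)
Lemma majslope_lev al be r t : max_lev al be r -> oitv al be t -> majslope t = r.
Proof.
move=> Hm tab; have [[[al0 albe bea r0] [H1 H2]] _] := Hm.
have rS : majset t r.
  split; first exact: ltW.
  exists al; first by rewrite al0 tab.1.
  move=> y [ty ya]; apply: (max_lev_right Hm); last exact: ltW.
  exact: lt_trans tab.1 ty.
have lbr : lbound (majset t) r.
  move=> c [c0 [x /andP[x0 xt] H]]; apply/ler_addgt0Pl => e e0.
  have [y [ty ybe] Hy] := max_lev_left Hm x0 xt e0 tab.
  have ya : (y%:E < a)%E by apply: lt_le_trans bea.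
  have Wxy : 0 < W y - W x by rewrite subr_gt0; apply: W_inc => //; [lra|exact: ltW].
  have := le_trans Hy (H y (conj ty ya)).
  by rewrite ler_pM2r//; lra.
apply/eqP; rewrite eq_le; apply/andP; split.
  by apply: ge_inf => //; exists r.
by apply: lb_le_inf => //; exists r.
Qed.

(** A common point forces equal slopes through [majslope]. If neither interval contained the other,
    their union would be a level interval of that slope. *)
Lemma max_lev_overlap al be r al' be' r' t :
  max_lev al be r -> max_lev al' be' r' -> oitv al be t -> oitv al' be' t ->
  oitv al be = oitv al' be'.
Proof.
wlog alal' : al be r al' be' r' / al <= al'.
  move=> H; have [] := leP al al'; first exact: H.
  by move=> /ltW + *; move=> ?; symmetry; apply: (H al' be' r' al be r).
move=> Hm Hm' tab tab'.
have rr' : r = r' by rewrite -(majslope_lev Hm tab) -(majslope_lev Hm' tab').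
subst r'.
have [[[al0 albe bea r0] [H1 H2]] Mm] := Hm.
have [[[al'0 albe' bea' _] [H1' H2']] Mm'] := Hm'.
have [bebe'|bebe'] := leP be' be.
  have /Mm' : lev_itv al be r by case: Hm.
  apply; move=> z [zal zbe]; split; first exact: le_lt_trans zal.
  exact: lt_le_trans bebe'.
move: alal'; rewrite le_eqVlt => /predU1P[alal'|alal'].
  subst al'; have /Mm : lev_itv al be' r by case: Hm'.
  by move=> -> //; move=> z [zal zbe]; split => //; exact: lt_trans bebe'.
exfalso.
have ina y : (y%:E < be')%E -> (y%:E <= a)%E by move=> /ltW /le_trans; apply.
(* Near [be] the slope from [al] is almost [r], while from [al'] it never exceeds [r]; subtracting
   leaves slope at least [r] from [al] to [al']. Here [W] is bounded before [be] because
   [be < be']. *)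
have Hal' : r * (W al' - W al) <= F al' - F al.
  apply/ler_addgt0Pl => e e0.
  have alt : al < t by exact: tab.1.
  have [M WM] : exists M, forall y, 0 <= y -> (y%:E < be)%E -> W y <= M.
    case: be bebe' {Hm H1 H2 Mm tab albe bea} => [b||].
    - move=> bb'; exists (W b) => y y0; rewrite lte_fin => yb.
      by apply: W_le => //; [exact: ltW|exact: ina].
    - by rewrite ltNge leey.
    - by move=> _; exists 0 => y y0; rewrite ltNge leNye.
  have M0 : 0 <= M by rewrite -W0; apply: WM => //; apply: le_lt_trans albe; rewrite lee_fin.
  pose d := e / (M + 1).
  have d0 : 0 < d by rewrite divr_gt0//; lra.
  have dE : d * (M + 1) = e by rewrite divfK// gt_eqF//; lra.
  have [y [ty ybe] Hy] := H2 d t d0 tab.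
  have al'y : al' < y by apply: lt_trans ty; exact: tab'.1.
  have y0 : 0 <= y by lra.
  have ya := ina _ (lt_trans ybe bebe').
  have Hy' := max_lev_right Hm' al'y ya.
  have WyM := WM y y0 ybe.
  have Wal : 0 <= W al by rewrite -W0; apply: W_le => //; exact: ina (lt_trans albe bebe').
  have Waly : W al <= W y by apply: W_le => //; lra.
  have : d * (W y - W al) <= d * (M + 1) by rewrite ler_pM2l//; lra.
  lra.
have L : lev_itv al be' r.
  split; first by split => //; exact: lt_trans bebe'.
  split.
    by move=> y [aly ybe]; apply: (max_lev_right Hm) => //; exact: ina.
  move=> e y e0 [aly ybe].
  have yy : oitv al' be' (Num.max y t).
    by split; rewrite ?lt_max ?tab'.1 ?orbT// EFin_max gt_max ybe tab'.2.
  have [z [+ zbe] Hz] := H2' e _ e0 yy; rewrite gt_max => /andP[yz tz].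
  exists z => //.
  have : 0 <= e * (W al' - W al).
    by rewrite mulr_ge0 ?ltW// subr_gt0; apply: W_inc => //; exact: ina albe'.
  lra.
have E : oitv al be' = oitv al be.
  by apply: Mm L _ => z [? ?]; split => //; exact: lt_trans bebe'.
case: be bebe' {bea H1 H2 Mm Hm} albe tab E => [b||]//= bb' alb tab E.
  have : oitv al be' b by split => //; move: alb; rewrite lte_fin.
  by rewrite E => -[_]; rewrite lte_fin ltxx.
by move: bb'; rewrite ltNge leey.
Qed.

Lemma majset_nonempty t : oitv 0 a t -> majset t !=set0.
Proof.
move=> [t0 ta].
have Wt : 0 < W t by rewrite -W0; apply: W_inc => //; exact: ltW.
(* For [y > t] the constant [A] is at most [A / W t * W y]. *)
exists (B + A / W t); split; first by rewrite addr_ge0// divr_ge0// ltW.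
exists 0; first by rewrite lexx.
move=> y [ty ya]; rewrite F0 W0 !subr0.
have WyWt : W t <= W y by apply: W_le; [exact: ltW|exact: ltW|exact: ltW].
apply: le_trans (F_le _) _; first by split => //; exact: lt_trans ty.
rewrite addrC mulrDl lerD2l -mulrA ler_peMr// mulrC ler_pdivlMr// mul1r//.
Qed.

Lemma majset_lbound t : lbound (majset t) 0.
Proof. by move=> c []. Qed.

Lemma majslope_ge0 t : oitv 0 a t -> 0 <= majslope t.
Proof.
move=> ta; apply: lb_le_inf; [exact: majset_nonempty|exact: majset_lbound].
Qed.

Lemma majslope_nincr t t' : oitv 0 a t -> t <= t' -> majslope t' <= majslope t.
Proof.
move=> ta tt'; apply: lb_le_inf; first exact: majset_nonempty.
move=> c [c0 [x /andP[x0 xt] H]]; apply: ge_inf; first by exists 0; exact: majset_lbound.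
split => //; exists x; first by rewrite x0 (lt_le_trans xt).
by move=> y [t'y ya]; apply: H; split => //; exact: le_lt_trans t'y.
Qed.

(** Strong differentiability of [F] with respect to [W] at [t]: both ends of the chord move, which
    allows chords that start or end beside [t]. *)
Definition slope_at (t c : R) : Prop := forall e : R, 0 < e ->
  exists2 d, [/\ 0 < d, 0 <= t - d & ((t + d)%:E <= a)%E] &
    forall z z', t - d < z -> z < z' -> z' < t + d ->
      (c - e) * (W z' - W z) <= F z' - F z <= (c + e) * (W z' - W z).

(** If all chords from [t] to the right have slope at most [c'], a point just left of [t] witnesses
    membership. Otherwise a chord that is too steep yields a level interval around [t]. *)
Lemma majset_slope t c c' : 0 <= c -> slope_at t c ->
  (forall al be r, lev_itv al be r -> ~ oitv al be t) -> c < c' -> majset t c'.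
Proof.
move=> c0 St Nt cc'.
have e0 : 0 < c' - c by lra.
have [d [d0 td ta] Hd] := St _ e0.
have {}Hd z z' : t - d < z -> z < z' -> z' < t + d -> F z' - F z <= c' * (W z' - W z).
  by move=> z1 z2 z3; have /andP[_] := Hd _ _ z1 z2 z3; rewrite subrKC.
split; first lra.
have [H|/existsNP[y /not_implyP[[ty ya] /negP]]] :=
    pselect (forall y, oitv t a y -> F y - F t <= c' * (W y - W t)).
  exists (t - d / 2); first by apply/andP; split; lra.
  move=> y ty; have := H y ty; have : F t - F (t - d / 2) <= c' * (W t - W (t - d / 2)).
    by apply: Hd; lra.
  lra.
(* By continuity the chord to [y] is still steeper than [c'] from some [x] left of [t], while chords
   from [x] to points near [t] are not. The maximal slope from [x] is thus attained beyond [t]. *)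
rewrite -ltNge => Hy.
pose G z := F z - c' * W z.
have cG : continuous G.
  by move=> z; apply: cvgB; [exact: cF|apply: cvgM; [exact: cvg_cst|exact: cW]].
have eta0 : 0 < G y - G t by rewrite /G; lra.
have [d1 d10 H1] := continuous_dist t cG eta0.
pose dd := Num.min d d1.
have dd0 : 0 < dd by rewrite lt_min d0.
have ddd : dd <= d by rewrite ge_min lexx.
have ddd1 : dd <= d1 by rewrite ge_min lexx orbT.
pose x := t - dd / 2.
have xt : x < t by rewrite /x; lra.
have x0 : 0 <= x by rewrite /x; lra.
have tdx : t - d < x by rewrite /x; lra.
have Gxy : G x < G y.
  have : `|t - x| < d1 by rewrite /x opprB addrC subrK ger0_norm; lra.
  by move=> /H1; rewrite ltr_norml => /andP[? ?]; lra.
have Fxy : c' * (W y - W x) < F y - F x by move: Gxy; rewrite /G; lra.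
have ya' : (y%:E <= a)%E by exact: ltW.
have [b [s [/andP[tb by'] Eb Hs]]] := slope_max x0 xt (ltW ty) ya'.
have Wxy : 0 < W y - W x by rewrite subr_gt0; apply: W_inc => //; lra.
have ta' : (t%:E <= a)%E by apply: le_trans ta; rewrite lee_fin; lra.
have Wxt : 0 < W t - W x by rewrite subr_gt0; apply: W_inc.
have c's : c' < s.
  by rewrite -(ltr_pM2r Wxy); apply: lt_le_trans Fxy _; apply: Hs; rewrite ltW//=.
have Fxt : F t - F x <= c' * (W t - W x) by apply: Hd; lra.
have {}tb : t < b.
  rewrite lt_neqAle tb andbT; apply/eqP => bE; move: Eb; rewrite -bE => Eb.
  have : s * (W t - W x) <= c' * (W t - W x) by rewrite -Eb.
  by rewrite ler_pM2r//; lra.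
have ba : (b%:E <= a)%E by apply: le_trans ya'.
have b0 : 0 < b by lra.
exfalso; suff L : lev_itv x b%:E s by have := Nt _ _ _ L; apply; split.
apply: (lev_end x0 _ ba _ (end_values_fin b0 ba) Eb); rewrite ?lte_fin; try lra.
move=> z [xz]; rewrite lte_fin => zb.
have [zt|tz] := leP z t; last by apply: Hs; apply/andP; split; lra.
have Hz : F z - F x <= c' * (W z - W x) by apply: Hd; lra.
apply: le_trans Hz _; rewrite ler_wpM2r//; last exact: ltW.
rewrite subr_ge0; apply: W_le => //; first exact: ltW.
by apply: le_trans ba; rewrite lee_fin ltW.
Qed.

(** If [c' < c], let [y] be just right of [t] and [al] a point of minimal slope to [y]. That slope
    is at most [c'], below the local slope at [t], so [al < t] and [(al, y)] is a level interval
    around [t]. *)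
Lemma majset_slope_ge t c c' : slope_at t c ->
  (forall al be r, lev_itv al be r -> ~ oitv al be t) -> majset t c' -> c <= c'.
Proof.
move=> St Nt [c'0 [x /andP[x0 xt] H]]; rewrite leNgt; apply/negP => c'c.
have e0 : 0 < (c - c') / 2 by lra.
have [d [d0 td ta] Hd] := St _ e0.
pose c2 := (c + c') / 2.
have {}Hd z z' : t - d < z -> z < z' -> z' < t + d -> c2 * (W z' - W z) <= F z' - F z.
  move=> z1 z2 z3; have /andP[+ _] := Hd _ _ z1 z2 z3.
  by have -> : c - (c - c') / 2 = c2 by rewrite /c2; field.
have c'2 : c' < c2 by rewrite /c2; lra.
pose y := t + d / 2.
have ty : t < y by rewrite /y; lra.
have yd : y < t + d by rewrite /y; lra.
have ya : (y%:E < a)%E by apply: lt_le_trans ta; rewrite lte_fin.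
have ya' := ltW ya.
have ta' : (t%:E <= a)%E by apply: le_trans ya'; rewrite lee_fin ltW.
have t0 : 0 <= t by lra.
have Wty : W t < W y by apply: W_inc.
have [al [s [/andP[xal alt] Eal Hs]]] := slope_min (F y) x0 (ltW xt) ta' Wty.
have Wxy : 0 < W y - W x by rewrite subr_gt0; apply: W_inc => //; lra.
have sc' : s <= c'.
  rewrite -(ler_pM2r Wxy); apply: le_trans (H y _); last by split.
  by apply: Hs; rewrite lexx ltW.
have Hty : c2 * (W y - W t) <= F y - F t by apply: Hd => //; lra.
have {}alt : al < t.
  rewrite lt_neqAle alt andbT; apply/eqP => E; move: Eal; rewrite E => Eal.
  have : c2 * (W y - W t) <= s * (W y - W t) by rewrite -Eal.
  by rewrite ler_pM2r; lra.
have al0 : 0 <= al by lra.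
have y0 : 0 < y by lra.
suff L : lev_itv al y%:E s by have := Nt _ _ _ L; apply; split; rewrite ?lte_fin.
apply: (lev_end al0 _ ya' _ (end_values_fin y0 ya') Eal); first by rewrite lte_fin; lra.
  have Waly : 0 < W y - W al by rewrite subr_gt0; apply: W_inc => //; lra.
  rewrite -(pmulr_lgt0 _ Waly) -Eal.
  have : F al <= F t by apply: F_nd => //; exact: ltW.
  have : 0 < c2 * (W y - W t) by rewrite mulr_gt0; lra.
  lra.
move=> z [alz]; rewrite lte_fin => zy.
have za : (z%:E <= a)%E by apply: le_trans ya'; rewrite lee_fin ltW.
have [zt|tz] := leP z t.
  have : s * (W y - W z) <= F y - F z by apply: Hs; apply/andP; split; lra.
  lra.
have : c2 * (W y - W z) <= F y - F z by apply: Hd => //; lra.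
have : s * (W y - W z) <= c2 * (W y - W z).
  rewrite ler_wpM2r//; last lra.
  by rewrite subr_ge0; apply: W_le => //; [lra|exact: ltW].
lra.
Qed.

Lemma majslope_slope t c : 0 <= c -> slope_at t c ->
  (forall al be r, lev_itv al be r -> ~ oitv al be t) -> majslope t = c.
Proof.
move=> c0 St Nt; apply/eqP; rewrite eq_le; apply/andP; split.
  apply/ler_addgt0Pl => e e0; apply: ge_inf; first by exists 0; exact: majset_lbound.
  by apply: (majset_slope c0) => //; lra.
apply: lb_le_inf; last by move=> c'; exact: majset_slope_ge.
by exists (c + 1); apply: (majset_slope c0) => //; lra.
Qed.

(* [lev_itv] without naming the slope: this form passes to unions of chains. *)
Definition lev_free (al : R) (be : \bar R) : Prop :=
  [/\ 0 <= al, (al%:E < be)%E, (be <= a)%E, (exists2 t, oitv al be t & F al < F t) &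
    forall t t' c, oitv al be t -> oitv al be t' ->
      c * (W t - W al) < F t - F al ->
      exists2 y, oitv t' be y & c * (W y - W al) < F y - F al].

Lemma oitv_W_lt al be t : 0 <= al -> (be <= a)%E -> oitv al be t -> W al < W t.
Proof.
by move=> al0 bea [alt tbe]; apply: W_inc => //; exact: le_trans (ltW tbe) bea.
Qed.

(** Beating [c] once forces [c < r], and the tail clause then beats [c] again arbitrarily near
    [be]. *)
Lemma lev_lev_free al be r : lev_itv al be r -> lev_free al be.
Proof.
move=> [[al0 albe bea r0] [H1 H2]].
have Wlt t : oitv al be t -> W al < W t by exact: oitv_W_lt.
split => //.
  have [t0 t0b] := between_oitv albe.
  have r20 : 0 < r / 2 by lra.
  have [y [ty ybe] Hy] := H2 _ _ r20 t0b.
  have yb : oitv al be y by split => //; exact: lt_trans t0b.1 ty.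
  exists y => //; rewrite -subr_gt0; apply: lt_le_trans Hy.
  by rewrite mulr_gt0 ?subr_gt0 ?Wlt//; lra.
move=> t t' c tb tb' Hc.
have Wt : 0 < W t - W al by rewrite subr_gt0 Wlt.
have cr : c < r by rewrite -(ltr_pM2r Wt); apply: lt_le_trans Hc _; exact: H1.
have e0 : 0 < (r - c) / 2 by lra.
have [y [ty ybe] Hy] := H2 _ _ e0 tb'.
exists y => //; apply: lt_le_trans Hy.
rewrite ltr_pM2r; first lra.
by rewrite subr_gt0 Wlt//; split => //; exact: lt_trans tb'.1 ty.
Qed.

(** The slope is recovered as the supremum of the values beaten strictly by some point. *)
Lemma lev_free_lev al be : lev_free al be -> exists r, lev_itv al be r.
Proof.
move=> [al0 albe bea [t0 t0b Ft0] H].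
have Wlt t : oitv al be t -> 0 < W t - W al.
  by move=> tb; rewrite subr_gt0; exact: oitv_W_lt tb.
pose S := [set c | exists2 t, oitv al be t & c * (W t - W al) < F t - F al].
pose c0 := (F t0 - F al) / (W t0 - W al) / 2.
have c00 : 0 < c0 by rewrite !divr_gt0 ?Wlt//; lra.
have c0S : S c0.
  exists t0 => //; rewrite /c0 mulrAC divfK ?gt_eqF ?Wlt//; lra.
have F_al : 0 <= F al by rewrite -F0; apply: F_nd => //; apply: le_trans bea; exact: ltW.
have W_al : 0 <= W al by rewrite -W0; apply: W_le => //; apply: le_trans bea; exact: ltW.
have ubS : ubound S (B + (A + B * W al) / (W t0 - W al)).
  move=> c [t tb Hc].
  have [y [ty ybe] Hy] := H _ _ _ tb t0b Hc.
  have y0 : 0 < y by apply: lt_trans ty; apply: le_lt_trans t0b.1.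
  have Fy : F y <= A + B * W y by apply: F_le; split => //; exact: lt_le_trans bea.
  have yb : oitv al be y by split => //; exact: lt_trans t0b.1 ty.
  rewrite -(ler_pM2r (Wlt _ yb)); apply: le_trans (ltW Hy) _.
  have : (A + B * W al) <= (A + B * W al) / (W t0 - W al) * (W y - W al).
    rewrite -mulrA ler_peMr ?addr_ge0 ?mulr_ge0//.
    rewrite mulrC ler_pdivlMr ?Wlt// mul1r lerB// W_le//.
    - by rewrite ltW// (le_lt_trans al0) ?t0b.1.
    - exact: ltW.
    - by apply: le_trans bea; exact: ltW.
  lra.
have hS : has_sup S by split; [exists c0|exists (B + (A + B * W al) / (W t0 - W al))].
exists (sup S); split.
  by split => //; apply: (lt_le_trans c00); exact: (ub_le_sup hS.2 c0S).
split.
  move=> t tb; rewrite -ler_pdivrMr ?Wlt//; apply/ler_addgt0Pl => e e0.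
  rewrite -lerBlDl; apply: ub_le_sup; first exact: hS.2.
  exists t => //; rewrite mulrBl divfK ?gt_eqF ?Wlt//.
  have : 0 < e * (W t - W al) by rewrite mulr_gt0 ?Wlt.
  lra.
move=> e t e0 tb; have [c [t1 t1b Hc] ce] := sup_adherent e0 hS.
have [y [ty ybe] Hy] := H _ _ _ t1b tb Hc.
exists y => //; apply: le_trans (ltW Hy); rewrite ler_pM2r ?Wlt//; first exact: ltW.
by split => //; exact: lt_trans tb.1 ty.
Qed.

Lemma total_on_cover2 (T : Type) (C : set (set T)) (x y : T) : total_on C subset ->
  (\bigcup_(X in C) X) x -> (\bigcup_(X in C) X) y ->
  exists2 X, C X & X x /\ X y.
Proof.
move=> Ct [X CX Xx] [Y CY Yy].
by have [XY|YX] := Ct _ _ CX CY; [exists Y|exists X] => //; split => //;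
  [exact: XY|exact: YX].
Qed.

(** The left ends of the members only approach [al], so the property of a member is transported to
    [al] by continuity, at the cost of a slightly smaller slope. *)
Lemma lev_free_chain (C : set (set R)) : C !=set0 -> total_on C subset ->
  (forall X, C X -> exists al be, X = oitv al be /\ lev_free al be) ->
  exists al be, \bigcup_(X in C) X = oitv al be /\ lev_free al be.
Proof.
move=> [X0 CX0] Ct CL.
pose U := \bigcup_(X in C) X.
have cover2 := total_on_cover2 Ct.
have CX_ne X : C X -> X !=set0.
  by move=> /CL [al [be [-> [_ albe _ _ _]]]]; exact: between_oitv.
have [x0 X0x0] := CX_ne _ CX0.
have Ux0 : U x0 by exists X0.
have U_gt0 : lbound U 0.
  by move=> x [X CX Xx]; have [al [be [XE [al0 _ _ _ _]]]] := CL _ CX;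
    move: Xx; rewrite XE => -[alx _]; apply: ltW; exact: le_lt_trans alx.
have hU : has_inf U by split; [exists x0|exists 0].
pose al := inf U.
pose be := ereal_sup (EFin @` U).
have al0 : 0 <= al by apply: lb_le_inf => //; exists x0.
have al_le X al' be' : C X -> X = oitv al' be' -> al <= al'.
  move=> CX XE; rewrite leNgt; apply/negP => al'al.
  have [x Xx] := CX_ne _ CX; move: (Xx); rewrite XE => -[al'x xbe'].
  have : X (Num.min x ((al' + al) / 2)).
    rewrite XE; split; first by rewrite lt_min al'x; lra.
    by apply: le_lt_trans xbe'; rewrite lee_fin ge_min lexx.
  move=> Xm; have : al <= Num.min x ((al' + al) / 2).
    by apply: ge_inf; [exact: hU.2|exists X].
  by rewrite le_min => /andP[_]; lra.
have U_sub : U `<=` oitv al be.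
  move=> x [X CX Xx]; have [al' [be' [XE _]]] := CL _ CX.
  move: (Xx); rewrite XE => -[al'x xbe']; split.
    exact: le_lt_trans (al_le _ _ _ CX XE) al'x.
  have [y [xy ybe']] := between_oitv xbe'.
  apply: (@lt_le_trans _ _ y%:E); first by rewrite lte_fin.
  apply: ereal_sup_ubound; exists y => //; exists X => //; rewrite XE; split => //.
  exact: lt_trans xy.
have sub_U : oitv al be `<=` U.
  move=> x [alx xbe].
  have [z1 Uz1 z1x] : exists2 z1, U z1 & z1 < x.
    have xal : 0 < x - al by rewrite subr_gt0.
    by have [z1 Uz1] := inf_adherent xal hU; rewrite -/al subrKC => z1x; exists z1.
  have [_ [z2 Uz2 <-] xz2] := ereal_sup_gt xbe.
  have [X CX [Xz1 Xz2]] := cover2 _ _ Uz1 Uz2.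
  have [al' [be' [XE _]]] := CL _ CX.
  exists X => //; rewrite XE in Xz1 Xz2 *; split.
    exact: lt_trans Xz1.1 z1x.
  exact: lt_trans Xz2.2.
have UE : U = oitv al be by apply/seteqP.
have x0ab : oitv al be x0 by rewrite -UE.
have albe : (al%:E < be)%E.
  by apply: lt_trans x0ab.2; rewrite lte_fin x0ab.1.
have bea : (be <= a)%E.
  apply: ge_ereal_sup => _ [x [X CX Xx] <-]; have [al' [be' [XE [_ _ be'a _ _]]]] := CL _ CX.
  by move: Xx; rewrite XE => -[_ xbe']; apply: le_trans be'a; exact: ltW.
have bexa y : (y%:E < be)%E -> (y%:E <= a)%E by move=> yb; apply: le_trans bea; exact: ltW.
exists al, be; split; first exact: UE.
split => //.
  have [al' [be' [X0E [al'0 _ be'a [t tb Ft] _]]]] := CL _ CX0.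
  have tab : oitv al be t by rewrite -UE; exists X0; rewrite // X0E.
  exists t => //; apply: le_lt_trans Ft; apply: F_nd => //; first exact: al_le CX0 X0E.
  by apply: le_trans be'a; apply: ltW; apply: lt_trans tb.2; rewrite lte_fin; exact: tb.1.
move=> t t' c tb tb' Hc.
have Walt := oitv_W_lt al0 bea tb.
have Walt' := oitv_W_lt al0 bea tb'.
have [c0|c0] := ltP c 0.
  have [y [t'y ybe]] := between_oitv tb'.2.
  exists y => //; have aly : al < y by apply: lt_trans tb'.1 t'y.
  have Fy : F al <= F y by apply: F_nd => //; [exact: ltW|exact: bexa].
  have Wy : W al < W y by apply: (oitv_W_lt al0 bea).
  have : c * (W y - W al) < 0 by rewrite nmulr_rlt0// subr_gt0.
  lra.
(* A value strictly between [c] and the slope at [t]; the gaps on its two sides pay for moving the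
   left end from [al] to that of a member and back. *)
pose c2 := (c + (F t - F al) / (W t - W al)) / 2.
have Wt0 : 0 < W t - W al by lra.
have cr : c < (F t - F al) / (W t - W al) by rewrite ltr_pdivlMr.
have cc2 : c < c2 by rewrite /c2; lra.
have Hc2 : c2 * (W t - W al) < F t - F al.
  by rewrite -ltr_pdivlMr// /c2; lra.
have eta1 : 0 < F t - F al - c2 * (W t - W al) by lra.
have eta2 : 0 < (c2 - c) * (W t' - W al) / c2.
  by rewrite divr_gt0 ?mulr_gt0//; lra.
have [d1 d10 Hd1] := continuous_dist al cF eta1.
have [d2 d20 Hd2] := continuous_dist al cW eta2.
(* A member containing [z] has its left end between [al] and [z], hence close to [al]. *)
have [z [alz zlt]] : exists z, oitv al (Num.min (Num.min t t') (Num.min (al + d1) (al + d2)))%:E z.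
  apply: between_oitv; rewrite lte_fin !lt_min tb.1 tb'.1/=; apply/andP; split; lra.
move: zlt; rewrite lte_fin !lt_min => /andP[/andP[zt zt'] /andP[zd1 zd2]].
have Uz : U z by rewrite UE; split => //; apply: lt_trans tb.2; rewrite lte_fin.
have Ut : U t by rewrite UE.
have Ut' : U t' by rewrite UE.
have [X CX [Xz XM]] : exists2 X, C X & X z /\ X (Num.max t t').
  by apply: cover2 => //; case: (leP t t').
have [al' [be' [XE [al'0 _ be'a _ HX]]]] := CL _ CX.
have alal' := al_le _ _ _ CX XE.
rewrite XE in Xz XM.
have al'z : al' < z by exact: Xz.1.
move: XM => [_]; rewrite EFin_max gt_max => /andP[tbe' t'be'].
have Fal' : `|F al - F al'| < F t - F al - c2 * (W t - W al).
  by apply: Hd1; rewrite ler0_norm; lra.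
have Wal' : `|W al - W al'| < (c2 - c) * (W t' - W al) / c2.
  by apply: Hd2; rewrite ler0_norm; lra.
move: Wal'; rewrite ltr_pdivlMr; last lra.
have al'a : (al'%:E <= a)%E.
  by apply: le_trans (bexa t tb.2); rewrite lee_fin ltW// (lt_trans al'z).
have Walal' : W al <= W al' by apply: W_le.
have Falal' : F al <= F al' by apply: F_nd.
rewrite ler0_norm; last lra.
move: Fal'; rewrite ler0_norm; last lra.
move=> Fal' Wal'.
have [|||y [t'y ybe'] Hy] := HX t t' c2.
- by split => //; exact: lt_trans zt.
- by split => //; exact: lt_trans zt'.
- have : c2 * (W t - W al') <= c2 * (W t - W al) by rewrite ler_wpM2l//; lra.
  lra.
have aly : al < y by apply: lt_trans tb'.1 t'y.
have yU : oitv al be y.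
  rewrite -UE; exists X => //; rewrite XE; split => //.
  by apply: lt_trans t'y; exact: lt_trans zt'.
exists y; first by split => //; exact: yU.2.
have Wty : W t' <= W y.
  by apply: W_le; [exact: le_trans al0 (ltW tb'.1)|exact: ltW|exact: bexa yU.2].
have : (c2 - c) * (W t' - W al) <= (c2 - c) * (W y - W al) by rewrite ler_wpM2l//; lra.
lra.
Qed.

Lemma lev_max al0 be0 r0 : lev_itv al0 be0 r0 ->
  exists al be r, max_lev al be r /\ oitv al0 be0 `<=` oitv al be.
Proof.
move=> L0.
pose P := [set X : set R | X = set0 \/
  (oitv al0 be0 `<=` X /\ exists al be, X = oitv al be /\ lev_free al be)].
have [|M [PM HM]] := @Zorn_bigcup _ P.
  move=> C CP Ct.
  have [[X [CX X0]]|HC] := pselect (exists X, C X /\ X <> set0); last first.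
    left; apply/seteqP; split => // x [X CX Xx].
    by apply: HC; exists X; split => // X0; rewrite X0 in Xx.
  right; split.
    by have [//|[XS _]] := CP _ CX; move=> t /XS; exists X.
  pose C' := [set Y | C Y /\ Y <> set0].
  have -> : \bigcup_(Y in C) Y = \bigcup_(Y in C') Y.
    apply/seteqP; split => x [Y CY Yx]; last by exists Y => //; case: CY.
    by exists Y => //; split => // Y0; rewrite Y0 in Yx.
  apply: lev_free_chain; first by exists X.
    by move=> Y Z [CY _] [CZ _]; exact: Ct.
  by move=> Y [CY Y0]; have [//|[_]] := CP _ CY.
have P0 : P (oitv al0 be0).
  by right; split => //; exists al0, be0; split => //; exact: lev_lev_free L0.
case: PM => [M0|[SM [al [be [ME Mlev]]]]].
  exfalso; apply: HM P0; rewrite M0; split; first exact: sub0set.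
  have [[_ albe _ _] _] := L0; have [t tb] := between_oitv albe.
  by move=> /(_ t tb).
have [r Lr] := lev_free_lev Mlev.
exists al, be, r; split; last by rewrite -ME.
split => // al' be' r' L' Sub; apply: contrapT => NE.
have : P (oitv al' be').
  right; split; first by rewrite ME in SM; exact: subset_trans Sub.
  by exists al', be'; split => //; exact: lev_lev_free L'.
apply: HM; rewrite ME; split => // Sub'; apply: NE; exact/seteqP.
Qed.

End Concave.

(** * Measurability of open intervals and additivity of integrals over them *)

Section OpenIntervals.
Context {R : realType}.
Local Open Scope ereal_scope.
Local Notation mu := (@lebesgue_measure R).

Lemma measurable_oitv (al : R) (be : \bar R) :
  measurable (oitv al be : set (measurableTypeR R)).
Proof.
apply: is_interval_measurable => x y [alx xbe] [aly ybe] z /andP[xz zy]; split.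
  exact: lt_le_trans xz.
by apply: le_lt_trans ybe; rewrite lee_fin.
Qed.
#[local] Hint Extern 0 (measurable (oitv _ _)) => apply: measurable_oitv : core.

(** Superlevel sets of a non-increasing function on an interval are intervals. *)
Lemma measurable_antitone (D : set (measurableTypeR R)) (h : R -> \bar R) :
  measurable D -> (forall s t, D s -> D t -> (s <= t)%R -> h t <= h s) ->
  is_interval D -> measurable_fun D h.
Proof.
move=> mD hD iD.
apply: (measurability _ (ErealGenCInfty.measurableE R)) => // _ [_ [r ->] <-].
apply: is_interval_measurable => s t [Ds hs] [Dt ht] u /andP[su ut].
move: hs ht; rewrite /preimage /= !in_itv/= !andbT => hs ht.
have Du : D u by apply: (iD s t) => //; rewrite su ut.
by split => //=; rewrite ?in_itv/= ?andbT (le_trans ht)// hD.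
Qed.

Lemma is_interval_oitv (al : R) (be : \bar R) : is_interval (oitv al be).
Proof.
move=> x y [alx xbe] [aly ybe] z /andP[xz zy]; split; first exact: lt_le_trans xz.
by apply: le_lt_trans ybe; rewrite lee_fin.
Qed.

Lemma oitvS (al al' : R) (be be' : \bar R) : (al' <= al)%R -> be <= be' ->
  oitv al be `<=` oitv al' be'.
Proof.
move=> al'al bebe' x [alx xbe]; split; first exact: le_lt_trans alx.
exact: lt_le_trans bebe'.
Qed.

Lemma oitv_empty (x : R) : oitv x x%:E = set0.
Proof.
by apply/seteqP; split => // y [xy]; rewrite lte_fin => /(lt_trans xy); rewrite ltxx.
Qed.

Lemma integral_oitv_split (al x : R) (be : \bar R) (g : R -> \bar R) :
  (al <= x)%R -> x%:E <= be -> measurable_fun (oitv al be : set (measurableTypeR R)) g ->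
  (forall t, oitv al be t -> 0 <= g t) ->
  \int[mu]_(t in oitv al be) g t =
    \int[mu]_(t in oitv al x%:E) g t + \int[mu]_(t in oitv x be) g t.
Proof.
rewrite le_eqVlt => /predU1P[<- *|alx]; first by rewrite oitv_empty integral_set0 add0e.
rewrite le_eqVlt => /predU1P[<- *|xbe mg g0].
  by rewrite oitv_empty integral_set0 adde0.
have E : oitv al be = oitv al x%:E `|` ([set x] `|` oitv x be).
  apply/seteqP; split => [t [alt tbe]|t [[alt]|[->|[xt tbe]]]].
  - have [tx|xt|->] := ltgtP t x; [by left; split|by right; right|by right; left].
  - by rewrite lte_fin => tx; split => //; apply: lt_trans xbe; rewrite lte_fin.
  - by split.
  - by split => //; exact: lt_trans xt.
rewrite E in mg g0 *.
have m2 : measurable ([set x] `|` oitv x be : set (measurableTypeR R)).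
  by apply: measurableU => //; exact: measurable_set1.
rewrite ge0_integral_setU//; last first.
  apply/disj_setPS => t [[_ +]]; rewrite lte_fin => tx [/= tE|[xt _]].
    by rewrite tE ltxx in tx.
  by have := lt_trans tx xt; rewrite ltxx.
rewrite ge0_integral_setU ?integral_set1 ?add0e//.
- apply: measurable_funS mg; last by move=> t; right.
  by apply: measurableU => //; exact: measurable_oitv.
- by move=> t tb; apply: g0; right.
- by apply/disj_setPS => t [/= -> [+ _]]; rewrite ltxx.
Qed.

Lemma lebesgue_measure_oitv (x y : R) : (x <= y)%R ->
  mu (oitv x y%:E) = (y - x)%:E.
Proof.
move=> xy; have -> : oitv x y%:E = `]x, y[%classic.
  by apply/seteqP; split => t; rewrite /oitv /= in_itv/= lte_fin;
    [move=> [-> ->]|move/andP].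
rewrite lebesgue_measure_itv/= lte_fin; case: ltgtP xy => // -> _.
by rewrite subrr.
Qed.

End OpenIntervals.

(** * Primitives of nonnegative non-increasing functions *)

Lemma clip_lip {R : realType} (b y z : R) : 0 <= b -> y <= z ->
  0 <= Num.max 0 (Num.min z b) - Num.max 0 (Num.min y b) <= z - y.
Proof.
move=> b0 yz; rewrite /Num.max /Num.min.
by do ! case: ifPn; rewrite -?leNgt => *; apply/andP; split; lra.
Qed.

Section AntitonePrimitive.
Context {R : realType} (a : \bar R) (h : R -> R).
Local Open Scope ereal_scope.
Local Notation mu := (@lebesgue_measure R).

Definition int_antitone : Prop :=
  [/\ 0 < a, forall t, oitv 0 a t -> (0 <= h t)%R,
      forall s t, oitv 0 a s -> oitv 0 a t -> (s <= t)%R -> (h t <= h s)%R &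
      forall t, oitv 0 a t -> \int[mu]_(x in oitv 0 t%:E) (h x)%:E < +oo].

Hypothesis hh : int_antitone.

(** Cutting the upper limit at [a] makes the primitive constant outside I, hence continuous on the
    whole line. *)
Definition prim (x : R) : R := fine (\int[mu]_(t in oitv 0 (mine x%:E a)) (h t)%:E).

Let h_ge0 t : oitv 0 a t -> 0 <= (h t)%:E.
Proof. by have [_ H _ _] := hh; rewrite lee_fin; exact: H. Qed.

Lemma measurable_int_antitone (al : R) (be : \bar R) : (0 <= al)%R -> be <= a ->
  measurable_fun (oitv al be : set (measurableTypeR R)) (EFin \o h).
Proof.
move=> al0 bea; apply: (measurable_funS _ (oitvS al0 bea)) => //.
  exact: measurable_oitv.
apply: measurable_antitone; [exact: measurable_oitv| |exact: is_interval_oitv].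
by have [_ _ H _] := hh; move=> s t sI tI st; rewrite lee_fin; exact: H.
Qed.

Lemma integral_antitone_le (x y : R) : (0 < x)%R -> (x <= y)%R -> y%:E <= a -> x%:E < a ->
  \int[mu]_(t in oitv x y%:E) (h t)%:E <= (h x * (y - x))%:E.
Proof.
move=> x0 xy ya xa; have mxy := measurable_oitv x y%:E.
have hx : 0 <= (h x)%:E by apply: h_ge0.
rewrite EFinM -(lebesgue_measure_oitv xy) -integral_cst//.
apply: ge0_le_integral => //.
- by move=> t [xt ty]; apply: h_ge0; split; [exact: lt_trans xt|exact: lt_le_trans ya].
- by apply: measurable_int_antitone => //; exact: ltW.
- move=> t [xt ty]; rewrite lee_fin; have [_ _ H _] := hh; apply: H => //; last exact: ltW.
  by split; [exact: lt_trans xt|exact: lt_le_trans ya].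
Qed.

Lemma integral_antitone_ge (x y : R) : (0 <= x)%R -> (x <= y)%R -> (0 < y)%R -> y%:E < a ->
  (h y * (y - x))%:E <= \int[mu]_(t in oitv x y%:E) (h t)%:E.
Proof.
move=> x0 xy y0 ya; have mxy := measurable_oitv x y%:E.
have hy : 0 <= (h y)%:E by apply: h_ge0.
rewrite EFinM -(lebesgue_measure_oitv xy) -integral_cst//.
apply: ge0_le_integral => //.
- by apply: measurable_int_antitone => //; exact: ltW.
- move=> t [xt ty]; rewrite lee_fin; have [_ _ H _] := hh; apply: H => //.
  + by split; [exact: le_lt_trans xt|exact: lt_trans ya].
  + by rewrite ltW// -lte_fin.
Qed.

Lemma prim_integral (x : R) : x%:E <= a ->
  \int[mu]_(t in oitv 0 x%:E) (h t)%:E = (prim x)%:E.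
Proof.
move=> xa; rewrite /prim min_l//; symmetry; apply: fineK.
rewrite ge0_fin_numE; last first.
  apply: integral_ge0 => t [t0 tx]; apply: h_ge0; split => //; exact: lt_le_trans xa.
have [x0|x0] := leP x 0%R.
  rewrite (_ : oitv _ _ = set0) ?integral_set0 ?ltry//.
  by apply/seteqP; split => // t [t0]; rewrite lte_fin => tx; have := lt_le_trans tx x0; rewrite ltNge ltW.
move: xa; rewrite le_eqVlt => /predU1P[xa|xa]; last first.
  by have [_ _ _ H] := hh; apply: H; split.
(* At [x = a] finiteness is not among the hypotheses. It follows by splitting at [x / 2], beyond
   which [h] is bounded by its value there. *)
have x20 : (0 < x / 2)%R by rewrite divr_gt0.
have x2x : (x / 2 < x)%R by rewrite ltr_pdivrMr// ltr_pMr// ltr1n.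
have x2a : (x / 2)%:E < a by rewrite -xa lte_fin.
rewrite (@integral_oitv_split _ 0 (x / 2)) ?lee_fin ?ltW//.
- apply: lte_add_pinfty; first by have [_ _ _ H] := hh; apply: H; split.
  by apply: le_lt_trans (integral_antitone_le x20 (ltW x2x) _ x2a) _; rewrite ?xa ?ltry.
- by apply: measurable_int_antitone => //; rewrite xa.
- by move=> t; rewrite xa; exact: h_ge0.
Qed.

Lemma prim_sub (x y : R) : (0 <= x)%R -> (x <= y)%R -> y%:E <= a ->
  \int[mu]_(t in oitv x y%:E) (h t)%:E = (prim y - prim x)%:E.
Proof.
move=> x0 xy ya.
have xa : x%:E <= a by apply: le_trans ya.
have := prim_integral ya; rewrite (@integral_oitv_split _ 0 x)//.
- rewrite prim_integral// => E.
  by rewrite EFinB -E addrAC subee// add0e.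
- by apply: measurable_int_antitone.
- by move=> t [t0 ty]; apply: h_ge0; split => //; exact: lt_le_trans ya.
Qed.

Lemma prim0 : prim 0 = 0%R.
Proof.
apply: EFin_inj; rewrite -prim_integral; last by have [/ltW] := hh.
by rewrite oitv_empty integral_set0.
Qed.

Lemma prim_npos (x : R) : (x <= 0)%R -> prim x = 0%R.
Proof.
move=> x0; apply: EFin_inj; rewrite -prim_integral; last first.
  by have [/ltW + _ _ _] := hh; apply: le_trans.
rewrite (_ : oitv _ _ = set0) ?integral_set0//; apply/seteqP; split => // t [t0].
by rewrite lte_fin => tx; have := lt_le_trans tx x0; rewrite ltNge ltW.
Qed.

Lemma prim_homo (x y : R) : (0 <= x)%R -> (x <= y)%R -> y%:E <= a ->
  (prim x <= prim y)%R.
Proof.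
move=> x0 xy ya; rewrite -subr_ge0 -lee_fin -prim_sub//.
apply: integral_ge0 => t [xt ty]; apply: h_ge0; split; first exact: le_lt_trans xt.
exact: lt_le_trans ya.
Qed.

Lemma prim_ge (x y : R) : (0 <= x)%R -> (x <= y)%R -> (0 < y)%R -> y%:E < a ->
  (h y * (y - x) <= prim y - prim x)%R.
Proof.
move=> x0 xy y0 ya; have ya' := ltW ya.
by rewrite -lee_fin -prim_sub//; exact: integral_antitone_ge.
Qed.

Lemma prim_le (x y : R) : (0 < x)%R -> (x <= y)%R -> y%:E <= a -> x%:E < a ->
  (prim y - prim x <= h x * (y - x))%R.
Proof.
move=> x0 xy ya xa; have x0' := ltW x0.
by rewrite -lee_fin -prim_sub//; exact: integral_antitone_le.
Qed.

Lemma prim_inc (x y : R) : (forall t, oitv 0 a t -> (0 < h t)%R) ->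
  (0 <= x)%R -> (x < y)%R -> y%:E <= a -> (prim x < prim y)%R.
Proof.
move=> h0 x0 xy ya; pose z := ((x + y) / 2)%R.
have xz : (x < z)%R by rewrite /z; lra.
have zy : (z < y)%R by rewrite /z; lra.
have za : z%:E < a by apply: lt_le_trans ya; rewrite lte_fin.
have z0 : (0 < z)%R by lra.
apply: (@lt_le_trans _ _ (prim z)); last by apply: prim_homo => //; exact: ltW.
rewrite -subr_gt0; apply: lt_le_trans (prim_ge x0 (ltW xz) z0 za).
by rewrite mulr_gt0 ?h0//; lra.
Qed.

Lemma eq_prim (x y : R) : mine x%:E a = mine y%:E a -> prim x = prim y.
Proof. by rewrite /prim => ->. Qed.

(* Otherwise unification compares primitives by unfolding the integrals. *)
Opaque prim.

(** Absolute continuity of the integral; [h] may be unbounded near 0, so no Lipschitz estimate is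
    available. *)
Lemma prim_unif (b : R) : b%:E <= a -> forall e : R, (0 < e)%R ->
  exists2 d, (0 < d)%R & forall x y, (0 <= x)%R -> (x <= y)%R -> (y <= b)%R ->
    (y - x < d)%R -> (prim y - prim x < e)%R.
Proof.
move=> ba e e0.
have mb := measurable_oitv 0 b%:E.
have ib : mu.-integrable (oitv 0 b%:E) (EFin \o h).
  apply/integrableP; split; first exact: measurable_int_antitone.
  under eq_integral.
    move=> t; rewrite inE => -[t0 tb]; rewrite gee0_abs; last first.
      by apply: h_ge0; split => //; exact: lt_le_trans ba.
    over.
  by rewrite prim_integral// ltry.
have iT : mu.-integrable setT (EFin \o h \_ (oitv 0 b%:E)).
  by rewrite -restrict_EFin; apply/integrable_restrict => //=; rewrite setTI.
have [d [d0 /= H]] := integral_normr_continuous iT e0.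
exists d => // x y x0 xy yb yxd.
have ya : y%:E <= a by apply: le_trans ba.
have mxy := measurable_oitv x y%:E.
have := H _ mxy; rewrite lebesgue_measure_oitv// lte_fin => /(_ yxd).
apply: le_lt_trans; rewrite /Rintegral.
rewrite [X in fine X](_ : _ = (prim y - prim x)%:E)//.
rewrite -prim_sub//; apply: eq_integral.
move=> t; rewrite inE => -[xt ty] /=.
have tb : oitv 0 b%:E t.
  by split; [exact: le_lt_trans xt|apply: lt_le_trans ty _; rewrite lee_fin].
rewrite patchE mem_set// ger0_norm// -lee_fin; apply: h_ge0.
by case: tb => t0 tb; split => //; exact: lt_le_trans ba.
Qed.

Lemma prim_continuous : continuous prim.
Proof.
move=> x.
(* Near [x] the primitive depends only on the point clipped to [[0, b]], where [prim_unif] applies;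
   clipping does not increase distances. *)
have [b [b0 ba bx]] : exists b : R, [/\ (0 <= b)%R, b%:E <= a &
    forall y, (`|x - y| < 1)%R -> mine y%:E a = mine (Num.min y b)%:E a].
  have [a0 _ _ _] := hh; case: (a) a0 => [r||]//.
    rewrite lte_fin => r0; exists r; split => //; first exact: ltW.
    move=> y _; rewrite EFin_min; case: (leP y%:E r%:E) => [yr|ry]; first by rewrite !min_l.
    by rewrite minxx.
  move=> _; exists (`|x| + 1)%R; split; rewrite ?leey ?addr_ge0//.
  move=> y xy; rewrite (@min_l _ _ y)//.
  have : (y <= `|y|)%R by exact: ler_norm.
  have := ler_normB x (x - y)%R; rewrite opprB addrCA subrr addr0.
  lra.
pose k y : R := Num.max 0%R (Num.min y b).
have primk y : (`|x - y| < 1)%R -> prim y = prim (k y).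
  move=> /bx/eq_prim ->.
  rewrite /k; move: (Num.min y b) => m.
  by case: leP => [//|/ltW m0]; rewrite prim0 prim_npos.
have kE y : (0 <= k y <= b)%R.
  by rewrite /k le_max lexx/= ge_max b0 ge_min lexx orbT.
have klip y z : (y <= z)%R -> (0 <= k z - k y <= z - y)%R by exact: clip_lip.
clearbody k.
apply/cvgrPdist_lt => e e0.
have [d d0 H] := prim_unif ba e0.
have primk_sub y z : (y <= z)%R -> (z - y < d)%R ->
    (0 <= prim (k z) - prim (k y) < e)%R.
  move=> yz zyd; have /andP[k1 k2] := klip _ _ yz.
  have /andP[k0y kyb] := kE y; have /andP[_ kzb] := kE z.
  apply/andP; split.
    rewrite subr_ge0; apply: prim_homo => //; first by rewrite -subr_ge0.
    by apply: le_trans ba; rewrite lee_fin.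
  by apply: H => //; [rewrite -subr_ge0|exact: le_lt_trans zyd].
apply/nbhs_ballP; exists (Num.min d 1%R); first by rewrite /= lt_min d0 ltr01.
move=> y; rewrite /ball /= lt_min => /andP[xy xy1].
rewrite (primk x) ?subrr ?normr0// (primk y)//.
move: (primk_sub x y) (primk_sub y x); move: (prim (k x)) (prim (k y)) => p q.
clear -xy e0; move: xy; rewrite !ltr_norml => /andP[xy1 xy2] H1 H2.
have [lexy|/ltW leyx] := leP x y.
  have /andP[] : (0 <= q - p < e)%R by apply: H1 => //; lra.
  by move=> *; apply/andP; split; lra.
have /andP[] : (0 <= p - q < e)%R by apply: H2 => //; lra.
by move=> *; apply/andP; split; lra.
Qed.

End AntitonePrimitive.

(* The previous declaration does not survive the end of the section. *)
Opaque prim.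

(** * Discontinuities of a monotone function, and slopes at common continuity points *)

Section Jumps.
Context {R : realType} (a : \bar R) (h : R -> R).
Hypothesis h_anti : forall s t, oitv 0 a s -> oitv 0 a t -> s <= t -> h t <= h s.

(* For each rational q, each of the two sets has at most one point. *)
Definition jumps : set R := \bigcup_(q in [set: rat])
  ([set t | oitv 0 a t /\ h t < ratr q /\ forall s, oitv 0 a s -> s < t -> ratr q <= h s] `|`
   [set t | oitv 0 a t /\ ratr q < h t /\ forall s, oitv 0 a s -> t < s -> h s <= ratr q]).

Let countable1 (S : set R) : (forall s t, S s -> S t -> s < t -> False) -> countable S.
Proof.
move=> HS; have [[t St]|S0] := pselect (exists t, S t).
  apply: (@sub_countable _ _ _ [set t]); last exact: countable1.
  apply: subset_card_le => s Ss /=; case: (ltgtP s t) => // st; exfalso; exact: HS st.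
rewrite (_ : S = set0) //; apply/seteqP; split => // s Ss; apply: S0; by exists s.
Qed.

Lemma countable_jumps : countable jumps.
Proof.
apply: bigcup_countable => // q _; rewrite -bigcup2E; apply: bigcup_countable => // -[|[|n]] _ //=.
- apply: countable1 => s t [sI [hs _]] [tI [_ /(_ s sI) H]] /H.
  by rewrite leNgt hs.
- apply: countable1 => s t [sI [_ /(_ t) H]] [tI [ht _]] /(H tI).
  by rewrite leNgt ht.
Qed.

(** If no [s < t] had [h s < h t + e], a rational between [h t] and [h t + e] would put [t] in
    [jumps]; similarly on the right. Monotonicity spreads the two one-point estimates over a
    neighbourhood. *)
Lemma nonjump_cont t e : oitv 0 a t -> ~ jumps t -> 0 < e ->
  exists2 d, [/\ 0 < d, 0 < t - d & ((t + d)%:E < a)%E] &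
    forall s, t - d < s -> s < t + d -> h t - e < h s < h t + e.
Proof.
move=> tI nj e0; have [t0 ta] := tI.
have [s1 [s1I s1t hs1]] : exists s, [/\ oitv 0 a s, s < t & h s < h t + e].
  have [q] : exists q, ratr q \in `]h t, h t + e[ by apply: rat_in_itvoo; rewrite ltrDl.
  rewrite in_itv/= => /andP[q1 q2]; apply: contrapT => H; apply: nj; exists q => //.
  left; split => //; split => // s sI st; rewrite leNgt; apply/negP => hsq.
  by apply: H; exists s; split => //; exact: lt_trans q2.
have [s2 [s2I ts2 hs2]] : exists s, [/\ oitv 0 a s, t < s & h t - e < h s].
  have [q] : exists q, ratr q \in `]h t - e, h t[ by apply: rat_in_itvoo; rewrite ltrBlDr ltrDl.
  rewrite in_itv/= => /andP[q1 q2]; apply: contrapT => H; apply: nj; exists q => //.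
  right; split => //; split => // s sI st; rewrite leNgt; apply/negP => hsq.
  by apply: H; exists s; split => //; exact: lt_trans hsq.
pose d := Num.min (t - s1) (s2 - t).
have d0 : 0 < d by rewrite lt_min !subr_gt0 s1t.
have d1 : d <= t - s1 by rewrite ge_min lexx.
have d2 : d <= s2 - t by rewrite ge_min lexx orbT.
clearbody d.
have s10 := s1I.1.
exists d.
  split => //; first lra.
  by apply: le_lt_trans s2I.2; rewrite lee_fin; lra.
move=> s sd1 sd2.
have sI : oitv 0 a s by split; [lra|apply: lt_trans s2I.2; rewrite lte_fin; lra].
have : h s <= h s1 by apply: h_anti => //; lra.
have : h s2 <= h s by apply: h_anti => //; lra.
by move=> *; apply/andP; split; lra.
Qed.

End Jumps.

Lemma slope_at_nonjump (R : realType) (a : \bar R) (u w : R -> R) (t : R) :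
  int_antitone a u -> int_antitone a w -> (forall s, oitv 0 a s -> 0 < w s) ->
  oitv 0 a t -> ~ jumps a u t -> ~ jumps a w t ->
  slope_at a (prim a u) (prim a w) t (u t / w t).
Proof.
move=> hu hw w_gt0 tI nu nw e e0.
move: (prim a u) (prim a w) (prim_ge hu) (prim_le hu) (prim_ge hw) (prim_le hw).
move=> F W Fge Fle Wge Wle.
have wt := w_gt0 t tI.
have ut : 0 <= u t by have [_ H _ _] := hu; exact: H.
set c := u t / w t.
have c0 : 0 <= c by rewrite divr_ge0// ltW.
have uE : u t = c * w t by rewrite divfK// gt_eqF.
clearbody c.
(* Chosen so that [u t + eta = (c + e) * (w t - eta)]; it also gives
   [(c - e) * (w t + eta) <= u t - eta]. *)
pose eta := e * w t / (1 + c + e).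
have k0 : 0 < 1 + c + e by lra.
have eta0 : 0 < eta by rewrite divr_gt0// mulr_gt0.
have etaE : eta * (1 + c + e) = e * w t by rewrite divfK// gt_eqF.
clearbody eta.
have [_ _ hua _] := hu; have [_ _ hwa _] := hw.
have [d1 [d10 td1 td1a] H1] := nonjump_cont hua tI nu eta0.
have [d2 [d20 td2 td2a] H2] := nonjump_cont hwa tI nw eta0.
pose d := Num.min d1 d2.
have dd1 : d <= d1 by rewrite ge_min lexx.
have dd2 : d <= d2 by rewrite ge_min lexx orbT.
have d0 : 0 < d by rewrite lt_min d10.
clearbody d.
exists d.
  split => //; first lra.
  by rewrite ltW//; apply: le_lt_trans td1a; rewrite lee_fin; lra.
move=> z z' dz zz' z'd.
have z0 : 0 < z by lra.
have z'0 : 0 < z' by lra.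
have z'a : (z'%:E < a)%E by apply: lt_trans td1a; rewrite lte_fin; lra.
have za : (z%:E < a)%E by apply: lt_trans z'a; rewrite lte_fin.
have F1 := Fge _ _ (ltW z0) (ltW zz') z'0 z'a.
have F2 := Fle _ _ z0 (ltW zz') (ltW z'a) za.
have W1 := Wge _ _ (ltW z0) (ltW zz') z'0 z'a.
have W2 := Wle _ _ z0 (ltW zz') (ltW z'a) za.
have uz : u z <= u t + eta.
  by have /andP[_ /ltW] : u t - eta < u z < u t + eta by apply: H1; lra.
have uz' : u t - eta <= u z'.
  by have /andP[/ltW + _] : u t - eta < u z' < u t + eta by apply: H1; lra.
have wz : w z <= w t + eta.
  by have /andP[_ /ltW] : w t - eta < w z < w t + eta by apply: H2; lra.
have wz' : w t - eta <= w z'.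
  by have /andP[/ltW + _] : w t - eta < w z' < w t + eta by apply: H2; lra.
have wz'0 : 0 < w z' by apply: w_gt0.
have dz0 : 0 <= z' - z by lra.
have uw1 : u z <= (c + e) * w z'.
  apply: le_trans uz _; apply: (@le_trans _ _ ((c + e) * (w t - eta))); first lra.
  by rewrite ler_wpM2l//; lra.
have DW : 0 <= W z' - W z.
  by apply: le_trans W1; rewrite mulr_ge0// ltW.
apply/andP; split; last first.
  apply: le_trans F2 _; apply: (@le_trans _ _ ((c + e) * w z' * (z' - z))).
    by rewrite ler_wpM2r.
  by rewrite -mulrA ler_wpM2l//; lra.
have [ce|ce] := leP (c - e) 0.
  apply: (@le_trans _ _ 0); first by rewrite mulr_le0_ge0.
  apply: le_trans F1; rewrite mulr_ge0//.
  by have [_ H _ _] := hu; apply: H.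
have uw2 : (c - e) * w z <= u z'.
  apply: le_trans uz'; apply: (@le_trans _ _ ((c - e) * (w t + eta))).
    by rewrite ler_wpM2l//; lra.
  have : 0 <= e * eta by rewrite mulr_ge0//; lra.
  lra.
apply: le_trans F1; apply: (@le_trans _ _ ((c - e) * w z * (z' - z))).
  by rewrite -mulrA ler_wpM2l//; lra.
by rewrite ler_wpM2r.
Qed.

(** * Correspondence between the level intervals of the definition and [lev_itv] *)

Section Levels.
Context {R : realType} (a : \bar R) (w f : R -> R) (A B : R).
Local Open Scope ereal_scope.
Local Notation mu := (@lebesgue_measure R).
Local Notation u := (fun t => fine (rearr a (EFin \o f) t)).
Hypothesis hu : int_antitone a u.
Hypothesis hw : int_antitone a w.
Hypothesis w_gt0 : forall t, oitv 0 a t -> (0 < w t)%R.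
Hypothesis rearr_fin : forall t, oitv 0 a t -> rearr a (EFin \o f) t \is a fin_num.
Local Notation F := (prim a u).
Local Notation W := (prim a w).
Hypothesis FW : growth_pair a F W A B.

Lemma Fint_prim (al b : R) : (0 <= al)%R -> (al <= b)%R -> b%:E <= a ->
  Fint a f al b%:E = (F b - F al)%:E.
Proof.
move=> al0 alb ba; rewrite -(prim_sub hu)//; apply: eq_integral => t.
rewrite inE => -[alt tb]; rewrite fineK//; apply: rearr_fin.
by split; [exact: le_lt_trans alt|exact: lt_le_trans ba].
Qed.

Lemma ratio_finE (al b : R) : (0 <= al)%R -> (al <= b)%R -> b%:E <= a ->
  ratio_fin a w f al b = ((F b - F al) / (W b - W al))%:E.
Proof.
by move=> al0 alb ba; rewrite /ratio_fin Fint_prim// /Wint (prim_sub hw).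
Qed.

Let W_lt (x y : R) : (0 <= x)%R -> (x < y)%R -> y%:E <= a -> (0 < W y - W x)%R.
Proof. by move=> *; rewrite subr_gt0; apply: (gp_incW FW). Qed.

Lemma oitv_sub_le (al : R) (be : \bar R) : al%:E < be -> oitv al be `<=` oitv 0 a -> be <= a.
Proof.
move=> albe S; rewrite leNgt; apply/negP => abe.
have [a0 _ _ _] := hu.
case: a a0 abe S => [r| |]//=; last by rewrite ltNge leey.
rewrite lte_fin => r0 rbe S.
have [y [aly ry ybe]] : exists y, [/\ (al < y)%R, (r < y)%R & y%:E < be].
  have [alr|/ltW ral] := leP al r.
    have [y [ry ybe]] := between_oitv rbe.
    by exists y; split => //; exact: le_lt_trans ry.
  have [y [aly ybe]] := between_oitv albe.
  by exists y; split => //; exact: le_lt_trans aly.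
by have [_] := S y (conj aly ybe); rewrite lte_fin => /(lt_trans ry); rewrite ltxx.
Qed.

Lemma slope_bounded (al t0 : R) : (0 <= al)%R -> (al < t0)%R -> t0%:E < a ->
  exists K, forall y, (t0 <= y)%R -> y%:E < a -> (F y - F al <= K * (W y - W al))%R.
Proof.
move=> al0 alt0 t0a.
have D0 : (0 < W t0 - W al)%R by apply: W_lt => //; exact: ltW.
have ala : al%:E <= a by apply: le_trans (ltW t0a); rewrite lee_fin ltW.
have Fal : (0 <= F al)%R by rewrite -(gp_F0 FW); apply: (gp_homoF FW).
have Wal : (0 <= W al)%R.
  move: al0; rewrite le_eqVlt => /predU1P[<-|al0]; first by rewrite (gp_W0 FW).
  by rewrite -(gp_W0 FW) ltW//; apply: (gp_incW FW).
have B0 := gp_B FW; have A0 := gp_A FW.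
exists (B + (A + B * W al) / (W t0 - W al))%R => y t0y ya.
have Fy : (F y <= A + B * W y)%R by apply: (gp_le FW); split => //; apply: lt_le_trans t0y; exact: le_lt_trans alt0.
have Wy : (W t0 - W al <= W y - W al)%R.
  rewrite lerD2r; move: t0y; rewrite le_eqVlt => /predU1P[->|t0y]; first exact: lexx.
  by apply: ltW; apply: (gp_incW FW) t0y (ltW ya); exact: le_trans (ltW alt0).
move: (F y) (F al) (W y) (W al) (W t0) Fal Wal D0 Fy Wy => Fy Fal Wy Wal Wt0 h1 h2 D0 h3 h4.
have : (A + B * Wal <= (A + B * Wal) / (Wt0 - Wal) * (Wy - Wal))%R.
  rewrite -mulrA ler_peMr ?addr_ge0 ?mulr_ge0//.
  by rewrite mulrC ler_pdivlMr// mul1r.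
lra.
Qed.

(* Unqualified, [ratio] is the one of mathcomp.algebra.fraction. *)
Lemma level_lev (al : R) (be : \bar R) : level_interval a w f al be ->
  exists r, Defs.ratio a w f al be = r%:E /\ lev_itv a F W al be r.
Proof.
move=> [al0 albe S r0 Hr]; have bea := oitv_sub_le albe S.
have ina y : oitv al be y -> y%:E <= a by move=> [_ /ltW /le_trans]; apply.
case: be albe S r0 Hr bea ina => [b| |]// albe S r0 Hr ba ina.
  have alb : (al < b)%R by [].
  have b0 : (0 < b)%R by lra.
  have Wab := W_lt al0 alb ba.
  exists ((F b - F al) / (W b - W al))%R; move: r0 Hr.
  rewrite /Defs.ratio (ratio_finE al0 (ltW alb) ba) => r0 Hr.
  split; first exact: erefl.
  apply: (lev_end FW al0 albe ba _ (end_values_fin FW b0 ba)) => //.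
    by rewrite divfK// gt_eqF.
  move=> t tb; have := Hr t tb; have [alt tltb] := tb.
  rewrite (ratio_finE al0 (ltW alt) (ina _ tb)) lee_fin ler_pdivrMr; first exact.
  exact: W_lt al0 alt (ina _ tb).
have aoo : a = +oo by apply/eqP; rewrite -leye_eq.
have ina' y : y%:E < a by rewrite aoo ltry.
pose L := Defs.ratio a w f al +oo.
(* The limit superior is an infimum over neighbourhoods of infinity, so each ray gives an upper
   bound; [slope_bounded] then makes it finite. *)
have Lsup M : L <= ereal_sup [set ratio_fin a w f al y | y in [set y | (M < y)%R]].
  by apply: ereal_inf_lbound; exists [set y | (M < y)%R] => //; exists M; split => //; exact: num_real.
have alt0 : (al < al + 1)%R by lra.
have [K HK] := slope_bounded al0 alt0 (ina' _).
have Lfin : L \is a fin_num.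
  rewrite fin_real// -/L; apply/andP; split; first exact: lt_trans r0.
  apply: le_lt_trans (Lsup (al + 1)%R) _; apply: (@le_lt_trans _ _ K%:E); last exact: ltry.
  apply: ge_ereal_sup => _ [y /= yM <-].
  have aly : (al < y)%R by exact: lt_trans yM.
  rewrite (ratio_finE al0 (ltW aly) (ltW (ina' y))) lee_fin ler_pdivrMr.
    by apply: HK => //; exact: ltW.
  by apply: W_lt => //; exact: ltW (ina' y).
exists (fine L); rewrite fineK//; split => //; split.
  by split => //; rewrite -lte_fin fineK.
have HrE t : (al < t)%R -> (F t - F al <= fine L * (W t - W al))%R.
  move=> alt; have := Hr t (conj alt (ltry _)).
  rewrite -/L -(fineK Lfin) /= (ratio_finE al0 (ltW alt) (ltW (ina' t))) lee_fin.
  by rewrite ler_pdivrMr//; apply: W_lt => //; exact: ltW (ina' t).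
split; first by move=> t [alt _]; exact: HrE.
move=> e t e0 [alt _]; apply: contrapT => H.
(* Without the tail clause at [t], all ratios beyond [t] would stay below [L - e]. *)
have : L <= (fine L - e)%:E.
  apply: le_trans (Lsup t) _; apply: ge_ereal_sup => _ [y /= yt <-].
  have aly : (al < y)%R by exact: lt_trans yt.
  rewrite (ratio_finE al0 (ltW aly) (ltW (ina' y))) lee_fin.
  rewrite ler_pdivrMr; last by apply: W_lt => //; exact: ltW (ina' y).
  rewrite leNgt; apply/negP => Hy; apply: H; exists y; last exact: ltW.
  by split => //; exact: ltry.
by rewrite -[leLHS](fineK Lfin) lee_fin; lra.
Qed.

Lemma lev_level (al : R) (be : \bar R) r : lev_itv a F W al be r ->
  level_interval a w f al be /\ Defs.ratio a w f al be = r%:E.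
Proof.
move=> L; have [[al0 albe bea r0] [H1 H2]] := L.
have ina y : oitv al be y -> y%:E <= a by move=> [_ /ltW /le_trans]; apply.
suff E : Defs.ratio a w f al be = r%:E.
  split=> //; split => //.
  - by move=> t [alt tbe]; split; [exact: le_lt_trans alt|exact: lt_le_trans bea].
  - by rewrite E lte_fin.
  - move=> t tb; have [alt tbe] := tb; rewrite E /= (ratio_finE al0 (ltW alt) (ina _ tb)).
    rewrite lee_fin ler_pdivrMr; first exact: H1.
    by apply: W_lt => //; exact: ina.
case: be L albe bea H1 H2 ina => [b| |]// L albe ba H1 H2 ina.
  have alb : (al < b)%R by [].
  have b0 : (0 < b)%R by lra.
  rewrite /= (ratio_finE al0 (ltW alb) ba) (lev_end_eq FW L (end_values_fin FW b0 ba)) mulfK//.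
  by rewrite gt_eqF//; exact: W_lt.
apply/eqP; rewrite eq_le; apply/andP; split.
  apply: (@le_trans _ _ (ereal_sup [set ratio_fin a w f al y | y in [set y | (al < y)%R]])).
    by apply: ereal_inf_lbound; exists [set y | (al < y)%R] => //; exists al; split => //; exact: num_real.
  apply: ge_ereal_sup => _ [y /= aly <-].
  have yb : oitv al +oo y by split => //; exact: ltry.
  rewrite (ratio_finE al0 (ltW aly) (ina _ yb)) lee_fin ler_pdivrMr; first exact: H1.
  by apply: W_lt => //; exact: ina.
apply: le_ereal_inf_tmp => _ [V [M [_ MV] <-]].
apply/lee_subgt0Pr => e e0.
have alM : oitv al +oo (Num.max (al + 1) M)%R.
  by split; [rewrite lt_max ltrDl ltr01|exact: ltry].
have [y [My _] Hy] := H2 e _ e0 alM.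
move: My; rewrite gt_max => /andP[aly My].
have {}aly : (al < y)%R by apply: lt_trans aly; rewrite ltrDl.
have yb : oitv al +oo y by split => //; exact: ltry.
apply: (@le_trans _ _ (ratio_fin a w f al y)).
  rewrite (ratio_finE al0 (ltW aly) (ina _ yb)) lee_fin ler_pdivlMr//.
  by apply: W_lt => //; exact: ina.
by apply: ereal_sup_ubound; exists y => //; exact: MV.
Qed.

Lemma max_level_lev (al : R) (be : \bar R) : maximal_level_interval a w f al be ->
  exists r, Defs.ratio a w f al be = r%:E /\ max_lev a F W al be r.
Proof.
move=> [/level_lev[r [rE Lr]] Hm]; exists r; split => //; split => // al' be' r' L' S.
by apply: Hm => //; have [] := lev_level L'.
Qed.

Lemma max_lev_level (al : R) (be : \bar R) r : max_lev a F W al be r ->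
  maximal_level_interval a w f al be.
Proof.
move=> [Lr Hm]; split; first by have [] := lev_level Lr.
by move=> al' be' /level_lev[r' [_ L']]; exact: Hm L'.
Qed.

Definition flat : set R := [set t | exists al be r, max_lev a F W al be r /\ oitv al be t].

Lemma level_function_flat t : flat t ->
  level_function a w f t = (majslope a F W t * w t)%:E.
Proof.
move=> [al [be [r [Hm tb]]]]; rewrite /level_function; case: pselect => [h|[]]; last first.
  by exists (al, be); split => //; exact: max_lev_level Hm.
case: cid => -[al' be'] /= [/max_level_lev[r' [-> Hm']] tb'].
by rewrite (majslope_lev FW Hm' tb').
Qed.

Lemma level_function_nonflat t : oitv 0 a t -> ~ flat t ->
  level_function a w f t = (u t)%:E.
Proof.
move=> tI Nt; rewrite /level_function; case: pselect => [[[al be] /= [Hm tb]]|_].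
  exfalso; apply: Nt; have [r [_ Hm']] := max_level_lev Hm.
  by exists al, be, r.
by rewrite fineK// rearr_fin.
Qed.

Lemma majslope_nonflat t : oitv 0 a t -> ~ flat t -> ~ jumps a u t -> ~ jumps a w t ->
  (majslope a F W t * w t = u t)%R.
Proof.
move=> tI Nt nu nw.
rewrite (@majslope_slope _ _ _ _ _ _ FW t (u t / w t)%R) ?divfK// ?gt_eqF ?w_gt0//.
- by have [_ H _ _] := hu; apply: divr_ge0; [exact: H|exact/ltW/w_gt0].
- exact: slope_at_nonjump.
(* Every level interval extends to a maximal one, so a point outside the maximal intervals avoids
   all level intervals. *)
- move=> al be r L tb; apply: Nt; have [al' [be' [r' [Hm S]]]] := lev_max FW L.
  by exists al', be', r'; split => //; exact: S.
Qed.

Lemma level_functionE t : oitv 0 a t -> ~ jumps a u t -> ~ jumps a w t ->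
  level_function a w f t = (majslope a F W t * w t)%:E.
Proof.
move=> tI nu nw; have [fl|nfl] := pselect (flat t); first exact: level_function_flat.
by rewrite level_function_nonflat// majslope_nonflat.
Qed.

End Levels.

(** * The primitive of k w compared with F *)

Section LevelIntegral.
Context {R : realType} (a : \bar R) (w f : R -> R) (A B : R).
Local Open Scope ereal_scope.
Local Notation mu := (@lebesgue_measure R).
Local Notation u := (fun t => fine (rearr a (EFin \o f) t)).
Hypothesis hu : int_antitone a u.
Hypothesis hw : int_antitone a w.
Hypothesis w_gt0 : forall t, oitv 0 a t -> (0 < w t)%R.
Hypothesis rearr_fin : forall t, oitv 0 a t -> rearr a (EFin \o f) t \is a fin_num.
Local Notation F := (prim a u).
Local Notation W := (prim a w).
Hypothesis FW : growth_pair a F W A B.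
Local Notation k := (majslope a F W).
Local Notation flat := (flat a w f).

(** Real-valued non-increasing version of the level function, equal to it off the jumps. *)
Definition level_density (t : R) : R := (k t * w t)%R.
Local Notation f0 := level_density.

Lemma level_density_ge0 t : oitv 0 a t -> (0 <= f0 t)%R.
Proof.
by move=> tI; apply: mulr_ge0; [exact: (majslope_ge0 FW tI)|exact/ltW/w_gt0].
Qed.

Lemma level_density_anti s t : oitv 0 a s -> oitv 0 a t -> (s <= t)%R ->
  (f0 t <= f0 s)%R.
Proof.
move=> sI tI st; apply: ler_pM.
- exact: (majslope_ge0 FW tI).
- exact/ltW/w_gt0.
- exact: (majslope_nincr FW sI st).
- by have [_ _ H _] := hw; exact: H.
Qed.

Lemma measurable_level_density al be : (0 <= al)%R -> be <= a ->
  measurable_fun (oitv al be : set (measurableTypeR R)) (EFin \o f0).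
Proof.
move=> al0 bea; apply: (measurable_funS _ (oitvS al0 bea)).
  exact: measurable_oitv.
apply: measurable_antitone; [exact: measurable_oitv| |exact: is_interval_oitv].
by move=> s t sI tI st; rewrite lee_fin; exact: level_density_anti.
Qed.

Let ge0_sub al be t : (0 <= al)%R -> be <= a -> oitv al be t -> 0 <= (f0 t)%:E.
Proof.
by move=> al0 bea tb; rewrite lee_fin; apply: level_density_ge0; exact: oitvS tb.
Qed.

Lemma level_density_max_lev al be r x : max_lev a F W al be r ->
  (al <= x)%R -> x%:E <= be ->
  \int[mu]_(t in oitv al x%:E) (f0 t)%:E = (r * (W x - W al))%:E.
Proof.
move=> Hm alx xbe; have [[[al0 albe bea r0] _] _] := Hm.
have xa := le_trans xbe bea.
rewrite EFinM -(prim_sub hw)//.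
rewrite -ge0_integralZl_EFin ?ltW//.
- apply: eq_integral => t; rewrite inE => -[alt tx].
  by rewrite -EFinM /f0 (majslope_lev FW Hm)//; split => //; exact: lt_le_trans xbe.
- exact: measurable_oitv.
- move=> t tb; rewrite lee_fin; apply/ltW/w_gt0; exact: oitvS tb.
- exact: (measurable_int_antitone hw).
Qed.

(** An interval containing [al] would overlap [(al, be)] to the right of [al], hence coincide with
    it. *)
Lemma max_lev_nonflat al be r : max_lev a F W al be r -> ~ flat al.
Proof.
move=> Hm [al' [be' [r' [Hm' [al'al albe']]]]].
have [[[al0 albe bea r0] _] _] := Hm.
have [t [alt tbe tbe']] : exists t, [/\ (al < t)%R, t%:E < be & t%:E < be'].
  have [bb|/ltW bb] := leP be be'.
    by have [t [alt tbe]] := between_oitv albe; exists t; split => //; exact: lt_le_trans bb.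
  by have [t [alt tbe]] := between_oitv albe'; exists t; split => //; exact: lt_le_trans bb.
have E : oitv al be = oitv al' be'.
  by apply: (max_lev_overlap FW Hm Hm' (t := t)); split => //; exact: lt_trans alt.
have : oitv al be al by rewrite E.
by case; rewrite ltxx.
Qed.

(* The maximal level interval containing y, or the empty set. *)
Let block (y : R) : set R :=
  [set z | exists al be r, [/\ max_lev a F W al be r, oitv al be y & oitv al be z]].

Let block_cases y : block y = set0 \/
  exists al be r, block y = oitv al be /\ max_lev a F W al be r.
Proof.
have [[al [be [r [Hm yb]]]]|N] := pselect (flat y); [right|left].
  exists al, be, r; split => //; apply/seteqP; split => [z [al' [be' [r' [Hm' yb' zb']]]]|z zb].
    by rewrite (max_lev_overlap FW Hm Hm' yb yb').
  by exists al, be, r.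
by apply/seteqP; split => // z [al [be [r [Hm yb _]]]]; apply: N; exists al, be, r.
Qed.

Let block_meet y z t : block y t -> block z t -> block y = block z.
Proof.
move=> yt zt.
have [y0|[al [be [r [yE Hm]]]]] := block_cases y; first by rewrite y0 in yt.
have [z0|[al' [be' [r' [zE Hm']]]]] := block_cases z; first by rewrite z0 in zt.
rewrite yE zE; rewrite yE in yt; rewrite zE in zt.
exact: (max_lev_overlap FW Hm Hm' yt zt).
Qed.

(** Each open interval contains a rational, so this lists all maximal intervals, with
    repetitions. *)
Let J (n : nat) : set R := if unpickle n is Some q then block (ratr (q : rat)) else set0.

Let J_cases n : J n = set0 \/ exists al be r, J n = oitv al be /\ max_lev a F W al be r.
Proof. by rewrite /J; case: unpickle => [q|]; [exact: block_cases|left]. Qed.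

Let J_meet m n t : J m t -> J n t -> J m = J n.
Proof.
rewrite /J; case: unpickle => [q|//]; case: unpickle => [q'|//]; exact: block_meet.
Qed.

Let flatE : flat = \bigcup_n J n.
Proof.
apply/seteqP; split => [t [al [be [r [Hm tb]]]]|t [n _]].
  have [t' [tt' t'be]] := between_oitv tb.2.
  have [q] := rat_in_itvoo tt'; rewrite in_itv/= => /andP[tq qt'].
  exists (pickle q); first exact: I.
  rewrite /J pickleK; exists al, be, r; split => //; split.
    exact: lt_trans tb.1 tq.
  by apply: lt_trans t'be; rewrite lte_fin.
rewrite /J; case: unpickle => [q|//] [al [be [r [Hm _ tb]]]].
by exists al, be, r.
Qed.

(** Members of the list are equal or disjoint, so making it disjoint keeps first occurrences whole
    and empties the repetitions. *)
Let DU_cases n : seqDU J n = set0 \/ seqDU J n = J n.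
Proof.
have [[m mn E]|N] := pselect (exists2 m, (m < n)%N & J m = J n).
  left; rewrite /seqDU; apply/seteqP; split => // t [Jt]; apply.
  by rewrite -bigcup_mkord; exists m; rewrite //= E.
right; rewrite /seqDU; apply/seteqP; split => [t []//|t Jt]; split => //.
rewrite -bigcup_mkord => -[m /= mn Jm]; apply: N; exists m => //.
exact: J_meet Jm Jt.
Qed.

Let measurableJ n : measurable (J n : set (measurableTypeR R)).
Proof.
by have [->|[al [be [r [-> _]]]]] := J_cases n; [exact: measurable0|exact: measurable_oitv].
Qed.

(* Each maximal interval carries the same mass for both densities, and countably
   many of them exhaust the set where the densities differ up to a null set. *)
Lemma level_density_nonflat x : (0 <= x)%R -> x%:E <= a -> ~ flat x ->
  \int[mu]_(t in oitv 0 x%:E) (f0 t)%:E = (F x)%:E.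
Proof.
move=> x0 xa Nx; pose D : set (measurableTypeR R) := oitv 0 x%:E.
have mD : measurable D by exact: measurable_oitv.
have DI : D `<=` oitv 0 a by exact: oitvS.
have mf0 : measurable_fun D (EFin \o f0) by exact: measurable_level_density.
have mu_ : measurable_fun D (EFin \o u) by exact: (measurable_int_antitone hu).
have f0_ge t : D t -> 0 <= (EFin \o f0) t by exact: ge0_sub.
have u_ge t : D t -> 0 <= (EFin \o u) t.
  by move=> /DI tI; rewrite lee_fin; have [_ H _ _] := hu; exact: H.
have mflat : measurable (flat : set (measurableTypeR R)).
  by rewrite flatE; apply: bigcup_measurable => n _; exact: measurableJ.
have mDJ n : measurable (D `&` seqDU J n).
  by apply: measurableI => //; exact: seqDU_measurable.
have DE : D = (\bigcup_n (D `&` seqDU J n)) `|` (D `\` flat).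
  by rewrite -setI_bigcupr -seqDU_bigcup_eq -flatE setDE -setIUr setUCr setIT.
have split_int (g : R -> \bar R) : measurable_fun D g -> (forall t, D t -> 0 <= g t) ->
    \int[mu]_(t in D) g t =
    \sum_(n <oo) \int[mu]_(t in D `&` seqDU J n) g t + \int[mu]_(t in D `\` flat) g t.
  move=> mg g0; have mUD : measurable (\bigcup_n (D `&` seqDU J n)).
    exact: bigcup_measurable.
  have SD : \bigcup_n (D `&` seqDU J n) `<=` D by move=> t [n _ []].
  rewrite {1}DE ge0_integral_setU//.
  - congr (_ + _); apply: ge0_integral_bigcup => //.
    + exact: measurable_funS mg.
    + by move=> t /SD; exact: g0.
    + apply/trivIsetP => i j _ _ ij; rewrite setIACA setIid.
      by have /trivIsetP/(_ i j I I ij) -> := trivIset_seqDU J; rewrite setI0.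
  - exact: measurableD.
  - by rewrite -DE.
  - by rewrite -DE.
  - apply/disj_setPS => t [[n _ [_ Jt]] [_ Nt]]; apply: Nt.
    by rewrite flatE; exists n; [exact: I|exact: subset_seqDU Jt].
rewrite -(prim_integral hu)//; rewrite (split_int (EFin \o f0))// (split_int (EFin \o u))//.
congr (_ + _).
  apply: eq_eseriesr => n _.
  have [->|->] := DU_cases n; first by rewrite setI0 !integral_set0.
  have [->|[al [be [r [-> Hm]]]]] := J_cases n; first by rewrite setI0 !integral_set0.
  have [[[al0 albe bea r0] _] _] := Hm.
  (* As [x] lies in no maximal interval, each one is entirely on one side of [x]; those on the left
     have a finite right end. *)
  have [xal|alx] := leP x al.
    rewrite (_ : _ `&` _ = set0) ?integral_set0//; apply/seteqP; split => // t [[_ tx] [alt _]].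
    by move: tx; rewrite lte_fin => /(lt_le_trans)/(_ xal)/(lt_trans alt); rewrite ltxx.
  have bex : be <= x%:E.
    by rewrite leNgt; apply/negP => xbe; apply: Nx; exists al, be, r.
  have -> : D `&` oitv al be = oitv al be.
    by apply/setIidPr; exact: oitvS.
  case: be albe bea Hm bex => [b| |]// alb ba Hm bx.
  have alb' : (al < b)%R by [].
  have b0 : (0 < b)%R by exact: le_lt_trans alb'.
  transitivity (r * (W b - W al))%:E.
    exact: (level_density_max_lev Hm (ltW alb') (lexx _)).
  rewrite -(lev_end_eq FW Hm.1 (end_values_fin FW b0 ba)).
  by rewrite -(prim_sub hu al0 (ltW alb') ba).
have cN : countable (jumps a u `|` jumps a w).
  by rewrite -bigcup2E; apply: bigcup_countable => // -[|[|n]] _ //=;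
    exact: countable_jumps.
have mDF : measurable (D `\` flat) by exact: measurableD.
apply: ge0_ae_eq_integral => //.
- by apply: measurable_funS mf0 => // t [].
- by apply: measurable_funS mu_ => // t [].
- by move=> t [/f0_ge].
- by move=> t [/u_ge].
exists (jumps a u `|` jumps a w); split.
- by apply: countable_measurable => //; exact: measurable_set1.
- exact: countable_lebesgue_measure0.
- move=> t /= Ht; apply: contrapT => /not_orP[nu nw]; apply: Ht => -[Dt Nt].
  have tI : oitv 0 a t by exact: DI.
  by rewrite /f0 (majslope_nonflat hu hw w_gt0 FW tI Nt nu nw).
Qed.

Lemma level_density_flat al be r x : max_lev a F W al be r -> (al <= x)%R -> x%:E <= be ->
  \int[mu]_(t in oitv 0 x%:E) (f0 t)%:E = (F al + r * (W x - W al))%:E.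
Proof.
move=> Hm alx xbe; have [[[al0 albe bea r0] _] _] := Hm; have xa := le_trans xbe bea.
rewrite (@integral_oitv_split _ 0 al)//; last 2 first.
- exact: measurable_level_density.
- by move=> t; exact: ge0_sub.
rewrite (level_density_max_lev Hm)// level_density_nonflat//.
- by apply: le_trans xa; rewrite lee_fin.
- exact: max_lev_nonflat Hm.
Qed.

Lemma int_antitone_level_density : int_antitone a f0.
Proof.
have [a0 _ _ _] := hu; split=> //; [exact: level_density_ge0|exact: level_density_anti|].
move=> x [x0 xa]; have [[al [be [r [Hm [alx xbe]]]]]|Nx] := pselect (flat x).
  by rewrite (level_density_flat Hm) ?ltW// ltry.
by rewrite level_density_nonflat ?ltW// ltry.
Qed.

Local Notation K := (prim a f0).

Lemma prim_nonflat x : (0 <= x)%R -> x%:E <= a -> ~ flat x -> K x = F x.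
Proof.
move=> x0 xa Nx; apply: EFin_inj; rewrite -(prim_integral int_antitone_level_density xa).
exact: level_density_nonflat.
Qed.

Lemma prim_flat al be r x : max_lev a F W al be r -> (al <= x)%R -> x%:E <= be ->
  K x = (F al + r * (W x - W al))%R.
Proof.
move=> Hm alx xbe; have [[[_ _ bea _] _] _] := Hm.
apply: EFin_inj; rewrite -(prim_integral int_antitone_level_density (le_trans xbe bea)).
exact: level_density_flat Hm alx xbe.
Qed.

Lemma prim_le_level_density x : oitv 0 a x -> (F x <= K x)%R.
Proof.
move=> [x0 xa]; have [[al [be [r [Hm [alx xbe]]]]]|Nx] := pselect (flat x).
  rewrite (prim_flat Hm (ltW alx) (ltW xbe)) addrC -lerBlDr.
  exact: (max_lev_right FW Hm alx (ltW xa)).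
by rewrite (prim_nonflat (ltW x0) (ltW xa) Nx).
Qed.

(** This replaces [K] by [F] in the supremum. On a maximal interval of slope [r > s] the function
    [K - s W] increases towards the right end, where [F] catches up with [K]. *)
Lemma level_density_tail s x e : oitv 0 a x -> (s < k x)%R -> (0 < e)%R ->
  exists2 y, oitv 0 a y & (K x - s * W x <= F y - s * W y + e)%R.
Proof.
move=> xI sk e0; have [x0 xa] := xI.
have [[al [be [r [Hm [alx xbe]]]]]|Nx] := pselect (flat x); last first.
  by exists x => //; rewrite (prim_nonflat (ltW x0) (ltW xa) Nx) lerDl ltW.
have kr : k x = r by exact: (majslope_lev FW Hm (conj alx xbe)).
rewrite kr in sk.
have [[[al0 albe bea r0] [H1 H2]] _] := Hm.
have Wx : (0 < W x - W al)%R by rewrite subr_gt0; exact: (gp_incW FW al0 alx (ltW xa)).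
(* The first bound keeps [r - s - d] nonnegative, so that moving from [x] to [y] loses nothing; the
   second limits the remaining loss [d * (W x - W al)] to [e]. *)
pose d := Num.min (r - s)%R (e / (W x - W al))%R.
have d0 : (0 < d)%R by rewrite lt_min subr_gt0 sk divr_gt0.
have dr : (d <= r - s)%R by rewrite ge_min lexx.
have de : (d * (W x - W al) <= e)%R by rewrite -ler_pdivlMr// ge_min lexx orbT.
have [y [xy ybe] Hy] := H2 d x d0 (conj alx xbe).
have ya : y%:E < a by exact: lt_le_trans bea.
exists y; first by split => //; exact: lt_trans xy.
have Wxy : (W x <= W y)%R by apply: ltW; exact: (gp_incW FW (ltW x0) xy (ltW ya)).
rewrite (prim_flat Hm (ltW alx) (ltW xbe)).
clearbody d; move: (F y) (F al) (W y) (W x) (W al) Wx Wxy de Hy => Fy Fal Wy Wx Wal Wxal Wxy de Hy.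
have : ((r - s - d) * (Wx - Wal) <= (r - s - d) * (Wy - Wal))%R.
  by apply: ler_wpM2l; [rewrite subr_ge0|rewrite lerD2r].
lra.
Qed.

End LevelIntegral.

(** * Decreasing rearrangements *)

Section Rearrangement.
Context {R : realType} (a : \bar R).
Local Open Scope ereal_scope.
Local Notation mu := (@lebesgue_measure R).

Lemma rearr_ge0 (g : R -> \bar R) t : 0 <= rearr a g t.
Proof. by apply: le_ereal_inf_tmp => _ [s [s0 _] <-]; rewrite lee_fin. Qed.

Lemma rearr_anti (g : R -> \bar R) s t : (s <= t)%R -> rearr a g t <= rearr a g s.
Proof.
move=> st; apply: ereal_inf_le_tmp => _ [r [r0 dr] <-]; exists r => //; split => //.
by apply: le_trans dr _; rewrite lee_fin.
Qed.

Lemma measurable_rearr (g : R -> \bar R) al be :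
  measurable_fun (oitv al be : set (measurableTypeR R)) (rearr a g).
Proof.
apply: measurable_antitone; [exact: measurable_oitv| |exact: is_interval_oitv].
by move=> s t _ _; exact: rearr_anti.
Qed.

(** The completed measure is given by an outer measure on all sets, so comparing distribution
    functions requires no measurability. *)
Let le_outer (X Y : set R) : X `<=` Y ->
  completed_lebesgue_measure X <= completed_lebesgue_measure Y.
Proof. exact: (@le_outer_measure _ _ (mu_ext (wlength (@idfun R)))). Qed.

Lemma rearr_antitone (h : R -> R) t :
  (forall s, oitv 0 a s -> (0 <= h s)%R) ->
  (forall s s', oitv 0 a s -> oitv 0 a s' -> (s <= s')%R -> (h s' <= h s)%R) ->
  oitv 0 a t -> ~ jumps a h t -> rearr a (EFin \o h) t = (h t)%:E.
Proof.
move=> h0 ha tI nj; have [t0 ta] := tI.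
apply/eqP; rewrite eq_le; apply/andP; split.
  apply: ereal_inf_lbound; exists (h t) => //; split; first exact: h0.
  rewrite /distr; apply: (@le_trans _ _ (mu (oitv 0 t%:E))).
    apply: le_outer => x [xI]; rewrite lte_fin ger0_norm ?h0// => hx.
    split; first exact: xI.1.
    by rewrite lte_fin ltNge; apply/negP => tx; have := ha _ _ tI xI tx; rewrite leNgt hx.
  by rewrite (lebesgue_measure_oitv (ltW t0)) subr0.
apply: le_ereal_inf_tmp => _ [s [s0 ds] <-]; rewrite lee_fin leNgt; apply/negP => st.
have e0 : (0 < h t - s)%R by rewrite subr_gt0.
have [d [d0 td tda] H] := nonjump_cont ha tI nj e0.
(* Continuity at [t] keeps [h] above [s] up to some [t' > t], so the superlevel set at [s] has
   measure larger than [t]. *)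
pose t' := (t + d / 2)%R.
have tt' : (t < t')%R by rewrite /t'; lra.
have t'd : (t' < t + d)%R by rewrite /t'; lra.
have t'a : t'%:E < a by apply: lt_trans tda; rewrite lte_fin.
have t'I : oitv 0 a t' by split => //; lra.
have st' : (s < h t')%R.
  have tdt' : (t - d < t')%R by rewrite /t'; lra.
  by have /andP[+ _] := H t' tdt' t'd; rewrite subKr.
move: ds; apply/negP; rewrite -ltNge; apply: (@lt_le_trans _ _ t'%:E); first by rewrite lte_fin.
have -> : t'%:E = mu (oitv 0 t'%:E).
  by rewrite (lebesgue_measure_oitv (ltW (lt_trans t0 tt'))) subr0.
apply: le_outer => x [x0 xt'].
have xI : oitv 0 a x by split => //; exact: lt_trans t'a.
split => //; rewrite lte_fin ger0_norm ?h0//; apply: lt_le_trans st' _.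
by apply: ha => //; rewrite ltW// -lte_fin.
Qed.

Lemma rearr_ae (N : set R) (g g' : R -> \bar R) : countable N ->
  (forall t, oitv 0 a t -> ~ N t -> g t = g' t) -> rearr a g = rearr a g'.
Proof.
move=> cN gg'; have N0 : completed_lebesgue_measure (N : set R) = 0.
  exact: (countable_lebesgue_measure0 cN).
have le_distr (g1 g2 : R -> \bar R) s : (forall t, oitv 0 a t -> ~ N t -> g1 t = g2 t) ->
    distr a g1 s <= distr a g2 s.
  move=> E; rewrite /distr -[leRHS]adde0 -N0.
  apply: le_trans (@outer_measureU2 _ _ (mu_ext (wlength (@idfun R))) _ _).
  apply: le_outer => x [xI sx]; have [Nx|nNx] := pselect (N x); [by right|left].
  by split => //; rewrite -E.
have E s : distr a g s = distr a g' s.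
  apply/eqP; rewrite eq_le !le_distr// => t tI Nt; by rewrite gg'.
apply/funext => t; rewrite /rearr; congr ereal_inf.
by apply/seteqP; split => _ [s [s0 H] <-]; exists s => //; split => //; move: H; rewrite E.
Qed.

Lemma rearr_scale (la : R) (g : R -> R) t : (0 < la)%R ->
  la%:E * rearr a (EFin \o g) t <= rearr a (fun x => (la * g x)%:E) t.
Proof.
move=> la0; apply: le_ereal_inf_tmp => _ [s [s0 ds] <-].
have -> : s%:E = la%:E * (s / la)%:E by rewrite -EFinM mulrC divfK// gt_eqF.
rewrite lee_pmul2l//; apply: ereal_inf_lbound; exists (s / la)%R => //; split.
  by rewrite divr_ge0// ltW.
move: ds; rewrite /distr; apply: le_trans; apply: le_outer => x [xI sx]; split => //.
by move: sx; rewrite !lte_fin normrM (gtr0_norm la0) ltr_pdivrMr// mulrC.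
Qed.

End Rearrangement.

(** * Convexity estimates and approximation of phi by hinges *)

Section Orlicz.
Context {R : realType} (phi : R -> R).
Hypothesis hphi : orlicz phi.

Lemma orlicz_convex t x y : 0 <= t -> t <= 1 -> 0 <= x -> 0 <= y ->
  phi (t * x + (1 - t) * y) <= t * phi x + (1 - t) * phi y.
Proof.
move=> t0 t1 x0 y0; have [H _ _] := hphi.
have t01 : (0 <= t <= 1) by rewrite t0 t1.
have := H (Itv01 t0 t1) x y; rewrite !inE /= !in_itv /= !andbT => /(_ x0 y0).
by rewrite !convRE.
Qed.

Let phi0 : phi 0 = 0. Proof. by have [] := hphi. Qed.

Lemma orlicz_ge0 x : 0 <= x -> 0 <= phi x.
Proof.
by rewrite le_eqVlt => /predU1P[<-|x0]; [rewrite phi0|have [_ _ H] := hphi; exact/ltW/H].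
Qed.

(** Convexity with the denominators cleared, so that degenerate triples are allowed. *)
Lemma orlicz_chord x y z : 0 <= x -> x <= y -> y <= z ->
  (z - x) * phi y <= (z - y) * phi x + (y - x) * phi z.
Proof.
move=> x0 xy yz; have [xz|zx] := ltP x z; last first.
  by have -> : y = x; [lra|have -> : z = x; [lra|rewrite !subrr !mul0r addr0]].
have D0 : 0 < z - x by lra.
pose t := (z - y) / (z - x).
have tE : t * (z - x) = z - y by rewrite divfK// gt_eqF.
have t0 : 0 <= t by rewrite divr_ge0//; lra.
have t1 : t <= 1 by rewrite ler_pdivrMr//; lra.
have z0 : 0 <= z by lra.
have := orlicz_convex t0 t1 x0 z0.
have -> : t * x + (1 - t) * z = y by lra.
move=> H; have := ler_wpM2l (ltW D0) H.
have -> : (z - x) * (t * phi x + (1 - t) * phi z) =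
  (t * (z - x)) * phi x + (z - x - t * (z - x)) * phi z by ring.
by rewrite tE; have -> : z - x - (z - y) = y - x by ring.
Qed.

Lemma orlicz_homo x y : 0 <= x -> x <= y -> phi x <= phi y.
Proof.
move=> x0; rewrite le_eqVlt => /predU1P[->//|xy].
have y0 : 0 < y by lra.
have := orlicz_chord (lexx 0) x0 (ltW xy); rewrite phi0 mulr0 add0r !subr0 => H.
rewrite -(ler_pM2l y0); apply: le_trans H _.
by rewrite ler_pM2r; [exact: ltW|have [_ _] := hphi; apply].
Qed.

(** Origin of the affine bound on [F]: a finite modular controls an integral up to a multiple of
    [W]. *)
Lemma orlicz_linear_lower v : 0 <= v -> v <= 1 + phi v / phi 1.
Proof.
move=> v0; have p1 : 0 < phi 1 by have [_ _] := hphi; apply.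
have [v1|v1] := leP v 1.
  by apply: le_trans v1 _; rewrite lerDl divr_ge0 ?orlicz_ge0// ltW.
have := orlicz_chord (lexx 0) ler01 (ltW v1); rewrite phi0 mulr0 add0r !subr0 mul1r => H.
have : v <= phi v / phi 1 by rewrite ler_pdivlMr.
lra.
Qed.

(** The slope to the left of [v] is at most the slope from [v] to [v + 1]; this gives left
    continuity with an explicit rate. *)
Lemma orlicz_left_cont v de : 0 <= de -> de <= v -> phi v - phi (v - de) <= de * phi (v + 1).
Proof.
move=> d0 dv; have := @orlicz_chord (v - de) v (v + 1).
move=> /(_ _ _ _)/wrap[|||H]; try lra.
have : phi (v - de) <= phi v by apply: orlicz_homo; lra.
have : 0 <= phi v by apply: orlicz_ge0; lra.
have : 0 <= de * phi v by rewrite mulr_ge0//; apply: orlicz_ge0; lra.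
by move: H; move: (phi v) (phi (v - de)) (phi (v + 1)) => p q r; nra.
Qed.

(* phi is bounded below by the chords over steps of length [d], shifted by [d]
   to the right; this piecewise affine function is the positive combination
   [hinges N] of the hinges [hinge ((i + 1) d)]. *)
Definition hinge (s v : R) : R := Num.max 0 (v - s).

Variable d : R.
Hypothesis d_gt0 : 0 < d.

Definition chord_slope (i : nat) : R := (phi (i.+1%:R * d) - phi (i%:R * d)) / d.

(** Increments of the chord slopes, so that the active hinges add up to the current slope; convexity
    makes them nonnegative. *)
Definition hinge_coef (i : nat) : R :=
  if i is j.+1 then chord_slope j.+1 - chord_slope j else chord_slope 0.

Definition hinges (N : nat) (v : R) : R :=
  \sum_(i < N) hinge_coef i * hinge (i.+1%:R * d) v.

Let pt_ge0 (i : nat) : 0 <= i%:R * d. Proof. by rewrite mulr_ge0// ltW. Qed.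
Let ptS (i : nat) : i.+1%:R * d = i%:R * d + d. Proof. by rewrite -natr1 mulrDl mul1r. Qed.

Let slopeE i : chord_slope i * d = phi (i.+1%:R * d) - phi (i%:R * d).
Proof. by rewrite divfK// gt_eqF. Qed.

Lemma chord_slope_ge0 i : 0 <= chord_slope i.
Proof.
apply: divr_ge0; last exact: ltW.
by rewrite subr_ge0; apply: orlicz_homo => //; rewrite ptS lerDl ltW.
Qed.

Lemma hinge_coef_ge0 i : 0 <= hinge_coef i.
Proof.
case: i => [|i] /=; first exact: chord_slope_ge0.
rewrite subr_ge0 -(ler_pM2r d_gt0) !slopeE.
have := @orlicz_chord (i%:R * d) (i.+1%:R * d) (i.+2%:R * d) (pt_ge0 i).
move=> /(_ _ _)/wrap[||]; rewrite ?ptS; try (have := d_gt0; lra).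
have -> : i%:R * d + d + d - i%:R * d = 2 * d by ring.
have -> : i%:R * d + d + d - (i%:R * d + d) = d by ring.
have -> : i%:R * d + d - i%:R * d = d by ring.
move=> H; rewrite -(ler_pM2l d_gt0).
by move: (phi _) (phi _) (phi _) H => p q r; nra.
Qed.

Lemma hinge_ge0 s v : 0 <= hinge s v.
Proof. by rewrite /hinge le_max lexx. Qed.

(** Past the last knot all hinges are active and the slopes telescope. The result is the chord of
    [phi] over the last step, shifted right by [d]. *)
Lemma hinges_affine N v : N.+1%:R * d <= v ->
  hinges N.+1 v = phi (N%:R * d) + chord_slope N * (v - N.+1%:R * d).
Proof.
have hE s : s <= v -> hinge s v = v - s by move=> sv; rewrite /hinge max_r// subr_ge0.
elim: N => [|N IH] Nv.
  by rewrite /hinges big_ord1 /= hE// mul0r phi0 add0r.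
rewrite /hinges big_ord_recr /= -/(hinges N.+1 v) IH; last first.
  by apply: le_trans Nv; rewrite ler_pM2r// ler_nat.
rewrite hE// (ptS N.+1) (ptS N).
have := slopeE N; rewrite ptS => E.
have -> : phi (N%:R * d + d) = chord_slope N * d + phi (N%:R * d) by rewrite E; ring.
ring.
Qed.

Lemma hinges_low N v : v <= N.+1%:R * d -> hinges N.+1 v = hinges N v.
Proof.
move=> vN; rewrite /hinges big_ord_recr /=.
have -> : hinge (N.+1%:R * d) v = 0 by rewrite /hinge max_l// subr_le0.
by rewrite mulr0 addr0.
Qed.

Lemma hinges_le N v : 0 <= v -> hinges N v <= phi v.
Proof.
move=> v0; elim: N => [|N IH]; first by rewrite /hinges big_ord0 orlicz_ge0.
have [vN|Nv] := leP v (N.+1%:R * d); first by rewrite hinges_low.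
rewrite hinges_affine; last exact: ltW.
have := @orlicz_chord (N%:R * d) (N.+1%:R * d) v (pt_ge0 N).
move=> /(_ _ _)/wrap[||]; [by rewrite ptS lerDl ltW|exact: ltW|].
have := slopeE N; rewrite ptS; rewrite ptS in Nv.
have -> : N%:R * d + d - N%:R * d = d by ring.
move=> E H; rewrite -(ler_pM2l d_gt0).
have m0 : 0 <= chord_slope N * d * d 
  by do 2 (apply: mulr_ge0; last exact: ltW); exact: chord_slope_ge0.
move: m0 E H; move: (N%:R * d) (chord_slope N) (phi (N%:R * d)) (phi (N%:R * d + d)) (phi v).
move=> x m p q r m0 E H; have qE : q = m * d + p by lra.
rewrite qE in H; lra.
Qed.

(** The shift and the grid each lose at most one step, so the sum is at least [phi (v - 2 * d)]; the
    explicit left continuity concludes. *)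
Lemma hinges_ge N v : 0 <= v -> v <= N.+1%:R * d -> phi v - 2 * d * phi (v + 1) <= hinges N v.
Proof.
move=> v0 vN; have pv1 : 0 <= phi (v + 1) by apply: orlicz_ge0; lra.
have [v2|v2] := leP v (2 * d).
  apply: (@le_trans _ _ 0).
    rewrite subr_le0.
    have vv1 : v <= v + 1 by rewrite lerDl.
    have := orlicz_chord (lexx 0) v0 vv1.
    rewrite phi0 mulr0 add0r !subr0 => H.
    have pv : 0 <= phi v by exact: orlicz_ge0.
    have : v * phi (v + 1) <= 2 * d * phi (v + 1) by rewrite ler_wpM2r.
    have : phi v <= (v + 1) * phi v by rewrite mulrDl mul1r lerDr mulr_ge0.
    lra.
  by apply: sumr_ge0 => i _; rewrite mulr_ge0 ?hinge_coef_ge0 ?hinge_ge0.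
apply: (@le_trans _ _ (phi (v - 2 * d))).
  have d2 : 0 <= 2 * d by rewrite mulr_ge0// ltW.
  have := orlicz_left_cont d2 (ltW v2); lra.
elim: N vN => [|N IH] vN; first by move: vN; rewrite mul1r; have := d_gt0; lra.
have [vN'|vN'] := leP v (N.+1%:R * d); first by rewrite hinges_low// IH.
rewrite hinges_affine ?(ltW vN')//; apply: (@le_trans _ _ (phi (N%:R * d))).
  by apply: orlicz_homo; [lra|move: vN; rewrite !ptS; lra].
by rewrite lerDl mulr_ge0 ?chord_slope_ge0// subr_ge0 ltW.
Qed.

End Orlicz.

(** With step [1 / (n + 1)] it takes [(n + 1)^2] hinges for the knots to reach [n + 1], hence
    eventually any [v]. *)
Lemma cvg_hinges (R : realType) (phi : R -> R) (v : R) : orlicz phi -> 0 <= v ->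
  hinges phi n.+1%:R^-1 (n.+1 * n.+1) v @[n --> \oo] --> phi v.
Proof.
move=> hphi v0; have dn0 n : 0 < n.+1%:R^-1 :> R by rewrite invr_gt0.
have cl : phi v - 2 * n.+1%:R^-1 * phi (v + 1) @[n --> \oo] --> phi v.
  rewrite -[X in _ --> X]subr0; apply: cvgB; first exact: cvg_cst.
  rewrite -(mul0r (phi (v + 1))) -(mulr0 2); apply: cvgM; last exact: cvg_cst.
  by apply: cvgM; [exact: cvg_cst|exact: cvg_harmonic].
apply: (squeeze_cvgr _ cl (cvg_cst (phi v))).
have : \forall n \near \oo, v <= n%:R by exact: nbhs_infty_ger.
apply: filterS => n vn; apply/andP; split; last by apply: hinges_le.
apply: hinges_ge => //; apply: le_trans vn _.
rewrite ler_pdivlMr// -natrM ler_nat.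
by rewrite (leq_trans _ (leqnSn _))// leq_mul.
Qed.

(** * Measurability and exhaustion for integrals against the weight *)

Section WeightedIntegral.
Context {R : realType} (a : \bar R) (w : R -> R).
Local Open Scope ereal_scope.
Local Notation mu := (@lebesgue_measure R).
Hypothesis hw : int_antitone a w.
Hypothesis w_gt0 : forall t, oitv 0 a t -> (0 < w t)%R.

Lemma integral_oitv_exhaust (be : \bar R) (p : R -> \bar R) (C : \bar R) : 0 < be ->
  measurable_fun (oitv 0 be : set (measurableTypeR R)) p ->
  (forall t, oitv 0 be t -> 0 <= p t) ->
  (forall x, oitv 0 be x -> \int[mu]_(t in oitv 0 x%:E) p t <= C) ->
  \int[mu]_(t in oitv 0 be) p t <= C.
Proof.
move=> be0 mp p0 H.
have [x [x_nd [x_lt x_ex]]] : exists x : nat -> R, {homo x : n m / (n <= m)%N >-> (n <= m)%R} /\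
    ((forall n, oitv 0 be (x n)) /\ forall t, oitv 0 be t -> exists n, (t < x n)%R).
  case: be be0 {mp p0 H} => [b| |]//.
    rewrite lte_fin => b0; exists (fun n => b - b / n.+2%:R)%R; split; last split.
    - move=> n m nm; rewrite lerD2l lerN2; apply: ler_wpM2l; first exact: ltW.
      by rewrite lef_pV2 ?posrE// ler_nat.
    - move=> n; split; last by rewrite lte_fin ltrBlDr ltrDl divr_gt0.
      by rewrite subr_gt0 ltr_pdivrMr// ltr_pMr// ltr1n.
    - move=> t [t0]; rewrite lte_fin => tb.
      have bt : (0 < b - t)%R by rewrite subr_gt0.
      have [n] : exists n : nat, (b / (b - t) < n%:R)%R.
        exists (Num.bound (b / (b - t)))%R; apply: archi_boundP.
        by rewrite divr_ge0// ltW.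
      rewrite ltr_pdivrMr// => Hn; exists n.
      rewrite ltrBrDl -ltrBrDr ltr_pdivrMr// (lt_le_trans Hn)// mulrC ler_pM2l//.
      by rewrite ler_nat; apply: (@leq_trans n.+1).
  move=> _; exists (fun n => n.+1%:R); split; last split.
  - by move=> n m nm; rewrite ler_nat.
  - by move=> n; split; [rewrite ltr0n|exact: ltry].
  - move=> t [t0 _]; exists (Num.bound t); apply: (@lt_trans _ _ (Num.bound t)%:R).
      exact: archi_boundP (ltW t0).
    by rewrite ltr_nat.
have UE : oitv 0 be = \bigcup_n oitv 0 (x n)%:E.
  apply/seteqP; split => [t tb|t [n _ [t0 tx]]].
    by have [n tn] := x_ex t tb; exists n => //; split => //; exact: tb.1.
  by split => //; exact: lt_trans tx (x_lt n).2.
have sub n : oitv 0 (x n)%:E `<=` oitv 0 be.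
  by apply: oitvS => //; exact: ltW (x_lt n).2.
have cv : \int[mu]_(t in oitv 0 (x n)%:E) p t @[n --> \oo] -->
    \int[mu]_(t in \bigcup_n oitv 0 (x n)%:E) p t.
  apply: ge0_nondecreasing_set_cvg_integral.
  - move=> n m nm; rewrite subsetEset; apply: oitvS => //.
    by rewrite lee_fin; exact: x_nd.
  - by move=> n; exact: measurable_oitv.
  - by move=> n; apply: measurable_funS mp => //; exact: measurable_oitv.
  - by move=> n t tn; apply: p0; exact: sub tn.
rewrite UE -(cvg_lim _ cv)//; apply: lime_le; first by apply/cvg_ex; eexists; exact: cv.
by apply: nearW => n; exact: H.
Qed.

Definition monotone_on_nneg (psi : R -> R) : Prop :=
  forall x y, (0 <= x)%R -> (x <= y)%R -> (psi x <= psi y)%R.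

Let winv_ge0 t : oitv 0 a t -> 0 <= ((w t)^-1)%:E.
Proof. by move=> tI; rewrite lee_fin invr_ge0; exact/ltW/w_gt0. Qed.

Lemma wint_integrand_ge0 (psi : R -> R) (v : \bar R) t :
  (forall x, (0 <= x)%R -> (0 <= psi x)%R) -> oitv 0 a t -> 0 <= v ->
  0 <= er_map psi (v * ((w t)^-1)%:E) * (w t)%:E.
Proof.
move=> psi0 tI v0; apply: mule_ge0; last by rewrite lee_fin; exact/ltW/w_gt0.
have : 0 <= v * ((w t)^-1)%:E by rewrite mule_ge0// winv_ge0.
by case: (_ * _) => [x| |]//=; rewrite lee_fin => /psi0; rewrite lee_fin.
Qed.

Lemma measurable_wint (psi : R -> R) (h : R -> \bar R) :
  monotone_on_nneg psi -> measurable_fun (oitv 0 a : set (measurableTypeR R)) h ->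
  (forall t, oitv 0 a t -> 0 <= h t) ->
  measurable_fun (oitv 0 a : set (measurableTypeR R))
    (fun t => er_map psi (h t * ((w t)^-1)%:E) * (w t)%:E).
Proof.
move=> psi_nd mh h0; have mI := measurable_oitv 0 a.
have mw : measurable_fun (oitv 0 a : set (measurableTypeR R)) (EFin \o w).
  exact: (measurable_int_antitone hw).
(* [1 / w] is non-decreasing, so it is its opposite that [measurable_antitone] handles. *)
have mwi : measurable_fun (oitv 0 a : set (measurableTypeR R)) (fun t => ((w t)^-1)%:E).
  apply: (@eq_measurable_fun _ _ _ _ _ (fun t => - (- (w t)^-1)%:E)).
    by move=> t _; rewrite -EFinN opprK.
  apply: measurableT_comp => //; apply: measurable_antitone => //; last exact: is_interval_oitv.
  move=> s t sI tI st; rewrite lee_fin lerN2 lef_pV2 ?posrE ?w_gt0//.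
  by have [_ _ H _] := hw; exact: H.
apply: emeasurable_funM => //.
(* [psi] is monotone on the nonnegative half-line only; composing with [Num.max 0] makes it monotone
   everywhere without changing the integrand. *)
apply: (@eq_measurable_fun _ _ _ _ _
  (er_map (fun x => psi (Num.max 0%R x)) \o (fun t => h t * ((w t)^-1)%:E))).
  move=> t; rewrite inE => tI /=.
  have : 0 <= h t * ((w t)^-1)%:E by rewrite mule_ge0// ?h0// winv_ge0.
  by case: (_ * _) => [x| |]//=; rewrite lee_fin => x0; rewrite max_r.
apply: measurableT_comp; last exact: emeasurable_funM.
apply: (@measurable_er_map _ (measurableTypeR R)).
apply: nondecreasing_measurable; first exact: measurableT.
move=> x y xy; apply: psi_nd; first by rewrite le_max lexx.
by rewrite ge_max le_max lexx/= le_max xy orbT.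
Qed.

(** All subsets of a countable set are measurable, so [g'] inherits measurability from [g]. In this
    way the level function needs no separate proof. *)
Lemma integral_eq_countable (D : set (measurableTypeR R)) (N : set R) (g g' : R -> \bar R) :
  measurable D -> countable N -> measurable_fun D g ->
  (forall t, D t -> 0 <= g t) -> (forall t, D t -> 0 <= g' t) ->
  (forall t, D t -> ~ N t -> g t = g' t) ->
  \int[mu]_(t in D) g t = \int[mu]_(t in D) g' t.
Proof.
move=> mD cN mg g0 g'0 E.
have mc (X : set (measurableTypeR R)) : X `<=` N -> measurable X.
  move=> XN; apply: countable_measurable; first by move=> t; exact: measurable_set1.
  exact: sub_countable (subset_card_le XN) cN.
have mg' : measurable_fun D g'.
  move=> _ Y mY.
  rewrite (_ : _ `&` _ = ((D `&` g @^-1` Y) `\` N) `|` (D `&` g' @^-1` Y `&` N)).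
    apply: measurableU; last by apply: mc => t [].
    by apply: measurableD; [exact: mg|exact: mc].
  apply/seteqP; split => [t [Dt Yt]|t [[[Dt Yt] Nt]|[]//]].
    have [Nt|Nt] := pselect (N t); [by right|left].
    by split => //; split => //; rewrite /preimage /= E.
  by split => //; rewrite /preimage /= -E.
apply: ge0_ae_eq_integral => //; exists N; split; [exact: mc|exact: countable_lebesgue_measure0|].
by move=> t /= Ht; apply: contrapT => Nt; apply: Ht => Dt; exact: E.
Qed.

End WeightedIntegral.

(** * The lower bound: first for hinges, then for phi *)

Section Domination.
Context {R : realType} (a : \bar R) (w f g : R -> R) (A B : R).
Local Open Scope ereal_scope.
Local Notation mu := (@lebesgue_measure R).
Local Notation u := (fun t => fine (rearr a (EFin \o f) t)).
Hypothesis hu : int_antitone a u.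
Hypothesis hw : int_antitone a w.
Hypothesis w_gt0 : forall t, oitv 0 a t -> (0 < w t)%R.
Hypothesis rearr_fin : forall t, oitv 0 a t -> rearr a (EFin \o f) t \is a fin_num.
Local Notation F := (prim a u).
Local Notation W := (prim a w).
Hypothesis FW : growth_pair a F W A B.
Hypothesis fg : prec a f g.
Local Notation k := (majslope a F W).
Local Notation f0 := (level_density a w f).
Local Notation g' := (rearr a (EFin \o g)).

Let mI : measurable (oitv 0 a : set (measurableTypeR R)). Proof. exact: measurable_oitv. Qed.

Let k_ge0 t : oitv 0 a t -> (0 <= k t)%R. Proof. exact: (majslope_ge0 FW). Qed.

Let mk : measurable_fun (oitv 0 a : set (measurableTypeR R)) (EFin \o f0).
Proof. exact: (measurable_level_density hw w_gt0 FW). Qed.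

Let f0_ge0 t : oitv 0 a t -> 0 <= (f0 t)%:E.
Proof. by move=> tI; rewrite lee_fin; exact: (level_density_ge0 w_gt0 FW). Qed.

Let mg' : measurable_fun (oitv 0 a : set (measurableTypeR R)) g'.
Proof. exact: measurable_rearr. Qed.

Lemma wint_level_density_integrand (psi : R -> R) t : oitv 0 a t ->
  er_map psi ((f0 t)%:E * ((w t)^-1)%:E) * (w t)%:E = (psi (k t) * w t)%:E.
Proof.
by move=> tI; rewrite -EFinM /level_density mulfK// gt_eqF// w_gt0.
Qed.

Lemma hinge_homo (s x y : R) : (x <= y)%R -> (hinge s x <= hinge s y)%R.
Proof. by move=> xy; rewrite /hinge ge_max !le_max lexx/= lerD2r xy orbT. Qed.

Let hinge_nd (s : R) : monotone_on_nneg (hinge s).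
Proof. by move=> x y _; exact: hinge_homo. Qed.

Lemma wint_hinge_le (s : R) : (0 <= s)%R ->
  wint (hinge s) a w (EFin \o f0) <= wint (hinge s) a w g'.
Proof.
move=> s0; pose P t := er_map (hinge s) (g' t * ((w t)^-1)%:E) * (w t)%:E.
pose C := \int[mu]_(t in oitv 0 a) P t; rewrite -[leRHS]/C.
have mP : measurable_fun (oitv 0 a : set (measurableTypeR R)) P.
  by apply: measurable_wint => // t _; exact: rearr_ge0.
have P0 t : oitv 0 a t -> 0 <= P t.
  move=> tI; apply: (wint_integrand_ge0 w_gt0) => //; last exact: rearr_ge0.
  by move=> x _; exact: hinge_ge0.
have C0 : 0 <= C by exact: integral_ge0.
(* This is [v <= (v - s)^+ + s] at [v = g' / w], multiplied by [w]. *)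
have g'P t : oitv 0 a t -> g' t <= P t + (s * w t)%:E.
  move=> tI; have wt := w_gt0 tI; rewrite /P.
  have : 0 <= g' t by exact: rearr_ge0.
  case: (g' t) => [x| |]//=; last first.
    have -> : +oo * ((w t)^-1)%:E = +oo by rewrite gt0_mulye// lte_fin invr_gt0.
    have -> : +oo * (w t)%:E = +oo by rewrite gt0_mulye// lte_fin.
    by rewrite leey.
  rewrite lee_fin => x0; rewrite -EFinM -EFinD lee_fin.
  have Hh : (x / w t - s <= hinge s (x / w t))%R by rewrite /hinge le_max lexx orbT.
  by rewrite -lerBlDr; have := ler_wpM2r (ltW wt) Hh; rewrite mulrBl divfK ?gt_eqF.
(* [C] may be infinite, so only the finite term [s * W y] changes sides. *)
have FC y : oitv 0 a y -> (F y - s * W y)%:E <= C.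
  move=> yI; have [y0 ya] := yI; have S : oitv 0 y%:E `<=` oitv 0 a by apply: oitvS => //; exact: ltW.
  have my := measurable_oitv 0 y%:E.
  rewrite EFinB leeBlDr//.
  have -> : (F y)%:E = \int[mu]_(t in oitv 0 y%:E) rearr a (EFin \o f) t.
    rewrite -(prim_integral hu (ltW ya)); apply: eq_integral => t; rewrite inE => ty.
    by rewrite fineK// rearr_fin//; exact: S.
  apply: le_trans (fg yI) _.
  have mwy : measurable_fun (oitv 0 y%:E : set (measurableTypeR R)) (fun t => s%:E * (w t)%:E).
    by apply: measurable_funeM; apply: (measurable_int_antitone hw) => //; exact: ltW.
  have w0y t : oitv 0 y%:E t -> 0 <= s%:E * (w t)%:E.
    by move=> /S tI; rewrite mule_ge0// lee_fin//; exact/ltW/w_gt0.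
  apply: (@le_trans _ _ (\int[mu]_(t in oitv 0 y%:E) (P t + s%:E * (w t)%:E))).
    apply: ge0_le_integral => //.
    - by move=> t _; exact: rearr_ge0.
    - exact: measurable_rearr.
    - by apply: emeasurable_funD => //; exact: measurable_funS mP.
    - by move=> t /S tI; rewrite -EFinM; exact: g'P.
  rewrite ge0_integralD//; last 2 first.
  - by move=> t /S; exact: P0.
  - exact: measurable_funS mP.
  apply: leeD; first exact: ge0_subset_integral.
  rewrite ge0_integralZl_EFin//.
  - by rewrite (prim_integral hw (ltW ya)) -EFinM.
  - by move=> t /S tI; rewrite lee_fin; exact/ltW/w_gt0.
  - by apply: (measurable_int_antitone hw) => //; exact: ltW.
pose p t := (hinge s (k t) * w t)%:E.
have -> : wint (hinge s) a w (EFin \o f0) = \int[mu]_(t in oitv 0 a) p t.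
  by apply: eq_integral => t; rewrite inE => tI; exact: wint_level_density_integrand.
have p0 t : oitv 0 a t -> 0 <= p t.
  by move=> tI; rewrite lee_fin mulr_ge0 ?hinge_ge0//; exact/ltW/w_gt0.
have mp : measurable_fun (oitv 0 a : set (measurableTypeR R)) p.
  apply: (@eq_measurable_fun _ _ _ _ _
      (fun t => er_map (hinge s) ((EFin \o f0) t * ((w t)^-1)%:E) * (w t)%:E)).
    by move=> t; rewrite inE; exact: wint_level_density_integrand.
  by apply: measurable_wint => // t; exact: f0_ge0.
(* On [(0, x)] the hinge is active throughout because [k] is non-increasing, so the integral is
   exactly [K x - s * W x]. *)
have pC x : oitv 0 a x -> (s < k x)%R -> \int[mu]_(t in oitv 0 x%:E) p t <= C.
  move=> xI sk; have [x0 xa] := xI.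
  have S : oitv 0 x%:E `<=` oitv 0 a by apply: oitvS => //; exact: ltW.
  have mx := measurable_oitv 0 x%:E.
  suff -> : \int[mu]_(t in oitv 0 x%:E) p t = (prim a f0 x - s * W x)%:E.
    apply/lee_addgt0Pr => e e0.
    have [y yI Hy] := level_density_tail hu hw w_gt0 FW xI sk e0.
    apply: (@le_trans _ _ (F y - s * W y + e)%:E); first by rewrite lee_fin.
    by rewrite EFinD leeD2r//; exact: FC.
  have := prim_integral (int_antitone_level_density hu hw w_gt0 FW) (ltW xa).
  have -> : \int[mu]_(t in oitv 0 x%:E) (f0 t)%:E =
      \int[mu]_(t in oitv 0 x%:E) (p t + s%:E * (w t)%:E).
    apply: eq_integral => t; rewrite inE => tx; rewrite /p -EFinM -EFinD; congr EFin.
    have kt : (s < k t)%R.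
      apply: lt_le_trans sk _; apply: (majslope_nincr FW); first exact: S.
      by case: tx => _; rewrite lte_fin => /ltW.
    rewrite /hinge max_r; last by rewrite subr_ge0 ltW.
    by rewrite mulrBl subrK.
  rewrite ge0_integralD//; last 4 first.
  - by move=> t /S; exact: p0.
  - exact: measurable_funS mp.
  - by move=> t /S tI; rewrite mule_ge0// lee_fin//; exact/ltW/w_gt0.
  - by apply: measurable_funeM; apply: (measurable_int_antitone hw) => //; exact: ltW.
  rewrite ge0_integralZl_EFin//; last 2 first.
  - by move=> t /S tI; rewrite lee_fin; exact/ltW/w_gt0.
  - by apply: (measurable_int_antitone hw) => //; exact: ltW.
  rewrite (prim_integral hw (ltW xa)) -EFinM => E.
  by rewrite EFinB -E addeK.
have [[z [zI sz]]|Nz] := pselect (exists z, oitv 0 a z /\ (s < k z)%R); last first.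
  rewrite (@eq_integral _ _ _ mu _ (cst 0)) ?integral0// => t; rewrite inE => tI.
  rewrite /p /hinge max_l ?mul0r// subr_le0 leNgt; apply/negP => st.
  by apply: Nz; exists t.
pose T := [set t | oitv 0 a t /\ (s < k t)%R].
(* Right end of the initial interval where [k > s]. [k] need not exceed [s] at [tau] itself, so the
   bound is carried to [tau] by exhaustion from inside. *)
pose tau := ereal_sup (EFin @` T).
have ztau : z%:E <= tau by apply: ereal_sup_ubound; exists z.
have tau0 : 0 < tau by apply: lt_le_trans ztau; rewrite lte_fin; exact: zI.1.
have taua : tau <= a by apply: ge_ereal_sup => _ [t [[_ ta] _] <-]; exact: ltW.
have kT x : oitv 0 tau x -> oitv 0 a x /\ (s < k x)%R.
  move=> [x0 /ereal_sup_gt[_ [y [yI sy] <-]]]; rewrite lte_fin => xy.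
  have xI : oitv 0 a x by split => //; apply: lt_trans yI.2; rewrite lte_fin.
  by split => //; apply: lt_le_trans sy _; apply: (majslope_nincr FW) => //; exact: ltW.
have Ctau : \int[mu]_(t in oitv 0 tau) p t <= C.
  apply: integral_oitv_exhaust => //.
  - by apply: measurable_funS mp => //; exact: oitvS.
  - by move=> t /kT[tI _]; exact: p0.
  - by move=> x /kT[xI sk]; exact: pC.
move: tau0 taua kT Ctau; rewrite /tau => {ztau}.
case E : (ereal_sup _) => [b| |]//.
  rewrite lte_fin => b0 ba kT Ctau.
  rewrite (@integral_oitv_split _ 0 b)//; last exact: ltW.
  rewrite [X in _ + X](_ : _ = 0) ?adde0//.
  rewrite (@eq_integral _ _ _ mu _ (cst 0)) ?integral0// => t; rewrite inE => -[bt ta].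
  rewrite /p /hinge max_l ?mul0r// subr_le0 leNgt; apply/negP => st.
  have : t%:E <= b%:E by rewrite -E; apply: ereal_sup_ubound; exists t => //; split => //; split => //; exact: lt_trans bt.
  by rewrite lee_fin leNgt bt.
move=> _ aoo kT Ctau; have -> // : a = +oo by apply/eqP; rewrite -leye_eq.
Qed.

Lemma wint_orlicz_le (phi : R -> R) : orlicz phi ->
  wint phi a w (EFin \o f0) <= wint phi a w g'.
Proof.
move=> hphi; pose C := wint phi a w g'; rewrite -[leRHS]/C.
have phi_nd : monotone_on_nneg phi by move=> x y; exact: orlicz_homo.
pose P s t := er_map (hinge s) (g' t * ((w t)^-1)%:E) * (w t)%:E.
pose p s t := (hinge s (k t) * w t)%:E.
have mP s : measurable_fun (oitv 0 a : set (measurableTypeR R)) (P s).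
  by apply: measurable_wint => // t _; exact: rearr_ge0.
have P0 s t : oitv 0 a t -> 0 <= P s t.
  move=> tI; apply: (wint_integrand_ge0 w_gt0) => //; last exact: rearr_ge0.
  by move=> x _; exact: hinge_ge0.
have p0 s t : oitv 0 a t -> 0 <= p s t.
  by move=> tI; rewrite lee_fin mulr_ge0 ?hinge_ge0//; exact/ltW/w_gt0.
have mp s : measurable_fun (oitv 0 a : set (measurableTypeR R)) (p s).
  apply: (@eq_measurable_fun _ _ _ _ _
      (fun t => er_map (hinge s) ((EFin \o f0) t * ((w t)^-1)%:E) * (w t)%:E)).
    by move=> t; rewrite inE; exact: wint_level_density_integrand.
  by apply: measurable_wint => // t; exact: f0_ge0.
have mwphi : measurable_fun (oitv 0 a : set (measurableTypeR R))
    (fun t => er_map phi (g' t * ((w t)^-1)%:E) * (w t)%:E).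
  by apply: measurable_wint => // t _; exact: rearr_ge0.
pose H d N t := (hinges phi d N (k t) * w t)%:E.
have HE d N t : H d N t = \sum_(i < N) (hinge_coef phi d i)%:E * p (i.+1%:R * d)%R t.
  rewrite /H /hinges mulr_suml -sumEFin; apply: eq_bigr => i _.
  by rewrite /p -EFinM mulrA.
have mH d N : measurable_fun (oitv 0 a : set (measurableTypeR R)) (H d N).
  rewrite (_ : H d N = fun t => \sum_(i < N) (hinge_coef phi d i)%:E * p (i.+1%:R * d)%R t).
    by apply: emeasurable_sum => i; exact: measurable_funeM.
  by apply/funext => t; exact: HE.
have H0 d N t : (0 < d)%R -> oitv 0 a t -> 0 <= H d N t.
  move=> d0 tI; rewrite HE; apply: sume_ge0 => i _.
  by rewrite mule_ge0 ?p0// lee_fin; exact: hinge_coef_ge0.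
have HC d N : (0 < d)%R -> \int[mu]_(t in oitv 0 a) H d N t <= C.
  move=> d0.
  have c0 i : (0 <= hinge_coef phi d i)%R by exact: hinge_coef_ge0.
  have -> : \int[mu]_(t in oitv 0 a) H d N t =
      \int[mu]_(t in oitv 0 a) \sum_(i < N) (hinge_coef phi d i)%:E * p (i.+1%:R * d)%R t.
    by apply: eq_integral => t _; exact: HE.
  rewrite ge0_integral_sum//; last 2 first.
  - by move=> i; exact: measurable_funeM.
  - by move=> i t tI; rewrite mule_ge0 ?p0// lee_fin.
  apply: (@le_trans _ _ (\sum_(i < N) \int[mu]_(t in oitv 0 a)
      ((hinge_coef phi d i)%:E * P (i.+1%:R * d)%R t))).
    apply: lee_sum => i _.
    rewrite !ge0_integralZl_EFin//; [|exact: P0|exact: p0].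
    apply: lee_wpmul2l; first by rewrite lee_fin.
    have s0 : (0 <= i.+1%:R * d)%R by rewrite mulr_ge0// ltW.
    apply: le_trans (wint_hinge_le s0); rewrite le_eqVlt; apply/orP; left; apply/eqP.
    by apply: eq_integral => t; rewrite inE => tI; rewrite wint_level_density_integrand.
  rewrite -ge0_integral_sum//; last 2 first.
  - by move=> i; exact: measurable_funeM.
  - by move=> i t tI; rewrite mule_ge0 ?P0// lee_fin.
  apply: ge0_le_integral => //.
  - by move=> t tI; apply: sume_ge0 => i _; rewrite mule_ge0 ?P0// lee_fin.
  - by apply: emeasurable_sum => i; exact: measurable_funeM.
  - move=> t tI; have wt := w_gt0 tI; rewrite /P.
    have : 0 <= g' t by exact: rearr_ge0.
    case: (g' t) => [x| |]//; last first.
      move=> _; rewrite [leRHS](_ : _ = +oo) ?leey// gt0_mulye ?lte_fin ?invr_gt0//.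
      by rewrite gt0_mulye// lte_fin.
    rewrite lee_fin => x0.
    rewrite (eq_bigr (fun i : 'I_N =>
      (hinge_coef phi d i * hinge (i.+1%:R * d) (x / w t) * w t)%:E)); last first.
      by move=> i _; rewrite -!EFinM mulrA.
    rewrite sumEFin -mulr_suml lee_fin ler_pM2r//.
    by apply: hinges_le => //; rewrite divr_ge0// ltW.
pose dn (n : nat) : R := (n.+1%:R^-1)%R.
pose Nn (n : nat) := (n.+1 * n.+1)%N.
have dn0 n : (0 < dn n)%R by rewrite invr_gt0.
(* The grids are not nested, so the limit is passed by Fatou's lemma; a bound from above is all that
   is wanted. *)
have -> : wint phi a w (EFin \o f0) =
    \int[mu]_(t in oitv 0 a) limn_einf (fun n => H (dn n) (Nn n) t).
  apply: eq_integral => t; rewrite inE => tI; rewrite wint_level_density_integrand//.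
  have cv : H (dn n) (Nn n) t @[n --> \oo] --> (phi (k t) * w t)%:E.
    by apply: cvg_EFin; [exact: nearW|apply: cvgM; [exact: (cvg_hinges hphi (k_ge0 tI))|exact: cvg_cst]].
  by have [-> _] := cvg_limn_einf_sup cv.
apply: le_trans (fatou mu mI (fun n => mH (dn n) (Nn n)) _) _.
  by move=> n t tI; exact: H0.
apply: le_trans (limn_einf_sup _) _.
apply: (@le_trans _ _ (ereal_sup [set \int[mu]_(t in oitv 0 a) H (dn n) (Nn n) t | n in [set: nat]])).
  by apply: ereal_inf_lbound; exists setT => //; exact: filterT.
by apply: ge_ereal_sup => _ [n _ <-]; exact: HC.
Qed.

End Domination.

(** * Consequences of membership in Q, and the two inequalities for the modular *)

Section Main.
Context {R : realType} (a : \bar R) (phi w f : R -> R).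
Local Open Scope ereal_scope.
Local Notation mu := (@lebesgue_measure R).
Hypothesis a_gt0 : 0 < a.
Hypothesis hphi : orlicz phi.
Hypothesis hw : weight a w.
Local Notation u := (fun t => fine (rearr a (EFin \o f) t)).
Local Notation F := (prim a u).
Local Notation W := (prim a w).

Lemma weight_gt0 t : oitv 0 a t -> (0 < w t)%R.
Proof. by have [H _ _] := hw; exact: H. Qed.

Lemma weight_int_antitone : int_antitone a w.
Proof. by have [H1 H2 H3] := hw; split => // t tI; exact/ltW/H1. Qed.

Let ia := weight_int_antitone.

Lemma Mclass_integral_rearr g : Mclass phi a w g ->
  exists A B, [/\ (0 <= A)%R, (0 <= B)%R & forall x, oitv 0 a x ->
    \int[mu]_(t in oitv 0 x%:E) rearr a (EFin \o g) t <= (A + B * W x)%:E].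
Proof.
move=> [_ [la [la0 Mfin]]].
pose lg := fun x => (la * g x)%:E.
pose h t := er_map phi (rearr a lg t * ((w t)^-1)%:E) * (w t)%:E.
have p1 : (0 < phi 1)%R by have [_ _] := hphi; apply.
have phi_nd : monotone_on_nneg phi by move=> x y; exact: orlicz_homo.
have mI := measurable_oitv 0 a.
have mh : measurable_fun (oitv 0 a : set (measurableTypeR R)) h.
  apply: (measurable_wint ia) => //; first exact: weight_gt0.
  + exact: measurable_rearr.
  + by move=> t _; exact: rearr_ge0.
have h0 t : oitv 0 a t -> 0 <= h t.
  move=> tI; apply: (wint_integrand_ge0 weight_gt0) => //; last exact: rearr_ge0.
  by move=> x; exact: orlicz_ge0.
pose M := fine (\int[mu]_(t in oitv 0 a) h t).
have ME : \int[mu]_(t in oitv 0 a) h t = M%:E.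
  by rewrite fineK// ge0_fin_numE//; exact: integral_ge0.
have M0 : (0 <= M)%R by rewrite -lee_fin -ME; exact: integral_ge0.
have c0 : (0 <= (phi 1)^-1)%R by rewrite invr_ge0 ltW.
(* [orlicz_linear_lower] at [rearr a lg t / w t], multiplied by [w t]; integrating yields [W x] plus
   a constant. *)
have pw t : oitv 0 a t -> rearr a lg t <= (w t)%:E + ((phi 1)^-1)%:E * h t.
  move=> tI; have wt := weight_gt0 tI; rewrite /h.
  have : 0 <= rearr a lg t by exact: rearr_ge0.
  case: (rearr a lg t) => [x| |]//; last first.
    move=> _; rewrite [leRHS](_ : _ = +oo) ?leey// gt0_mulye ?lte_fin ?invr_gt0//.
    by rewrite gt0_mulye ?lte_fin// gt0_muley ?lte_fin ?invr_gt0// addey.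
  rewrite lee_fin => x0; rewrite -!EFinM -EFinD lee_fin.
  have xw : (0 <= x / w t)%R by rewrite divr_ge0// ltW.
  have := ler_wpM2r (ltW wt) (orlicz_linear_lower hphi xw).
  by rewrite divfK ?gt_eqF// mulrDl mul1r mulrAC mulrC mulrA.
exists (M / phi 1 / la)%R, (la^-1)%R; split.
- by rewrite divr_ge0 ?divr_ge0 ?(ltW p1) ?(ltW la0).
- by rewrite invr_ge0 ltW.
move=> x xI; have [x0 xa] := xI.
have S : oitv 0 x%:E `<=` oitv 0 a by apply: oitvS => //; exact: ltW.
have mx := measurable_oitv 0 x%:E.
suff H : la%:E * \int[mu]_(t in oitv 0 x%:E) rearr a (EFin \o g) t <= (W x + M / phi 1)%:E.
  have li0 : 0 <= (la^-1)%:E by rewrite lee_fin invr_ge0 ltW.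
  have := lee_wpmul2l li0 H; rewrite muleA -EFinM mulVf ?gt_eqF// mul1e -EFinM.
  by move=> /le_trans; apply; rewrite lee_fin mulrDr addrC [(la^-1 * (M / _))%R]mulrC.
have mr : measurable_fun (oitv 0 x%:E : set (measurableTypeR R)) (rearr a (EFin \o g)).
  exact: measurable_rearr.
rewrite -ge0_integralZl_EFin//; [|by move=> t _; exact: rearr_ge0|exact: ltW].
have mwx : measurable_fun (oitv 0 x%:E : set (measurableTypeR R)) (EFin \o w).
  by apply: (measurable_int_antitone ia) => //; exact: ltW.
have mhx : measurable_fun (oitv 0 x%:E : set (measurableTypeR R)) h by exact: measurable_funS mh.
apply: (@le_trans _ _ (\int[mu]_(t in oitv 0 x%:E) ((w t)%:E + ((phi 1)^-1)%:E * h t))).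
  apply: ge0_le_integral => //.
  - by move=> t _; rewrite mule_ge0 ?rearr_ge0// lee_fin ltW.
  - by apply: measurable_funeM; exact: measurable_rearr.
  - by apply: emeasurable_funD => //; exact: measurable_funeM.
  - by move=> t /S tI; apply: le_trans (rearr_scale _ _ _ _) _ => //; exact: pw.
rewrite ge0_integralD//; last 3 first.
- by move=> t /S tI; rewrite lee_fin; exact/ltW/weight_gt0.
- by move=> t /S tI; rewrite mule_ge0 ?h0.
- exact: measurable_funeM.
rewrite EFinD; apply: leeD; first by rewrite (prim_integral ia (ltW xa)).
rewrite ge0_integralZl_EFin//; last by move=> t /S; exact: h0.
rewrite mulrC EFinM; apply: lee_wpmul2l => //.
by rewrite -ME; exact: ge0_subset_integral.
Qed.

Hypothesis hf : Qclass phi a w f.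

Lemma Qclass_growth : (forall t, oitv 0 a t -> rearr a (EFin \o f) t \is a fin_num) /\
  int_antitone a u /\ exists A B, growth_pair a F W A B.
Proof.
have [_ [g [gM fg]]] := hf.
have [A [B [A0 B0 AB]]] := Mclass_integral_rearr gM.
have bnd x : oitv 0 a x -> \int[mu]_(t in oitv 0 x%:E) rearr a (EFin \o f) t <= (A + B * W x)%:E.
  by move=> xI; apply: le_trans (fg _ xI) _; exact: AB.
have fin t : oitv 0 a t -> rearr a (EFin \o f) t \is a fin_num.
  move=> tI; have [t0 ta] := tI.
  have r0 : 0 <= rearr a (EFin \o f) t by exact: rearr_ge0.
  (* An infinite value at [t] would be taken on all of [(0, t)], making an integral with a finite
     bound infinite. *)
  rewrite ge0_fin_numE// ltNge leye_eq; apply/negP => /eqP E.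
  have mt := measurable_oitv 0 t%:E.
  have : \int[mu]_(x in oitv 0 t%:E) (cst +oo) x <= (A + B * W t)%:E.
    apply: le_trans (bnd _ tI); apply: ge0_le_integral;
      [exact: mt|by move=> x _; exact: le0y|exact: measurable_cst|exact: measurable_rearr|].
    by move=> x [x0 xt]; rewrite -E; apply: rearr_anti; rewrite ltW// -lte_fin.
  rewrite integral_cst// [X in +oo * X](_ : _ = (t - 0)%:E); last first.
    exact: (lebesgue_measure_oitv (ltW t0)).
  by rewrite subr0 gt0_mulye ?lte_fin.
split => //.
have hu : int_antitone a u.
  split => //.
  - by move=> t tI; rewrite fine_ge0// rearr_ge0.
  - by move=> s t sI tI st; rewrite fine_le ?fin//; exact: rearr_anti.
  - move=> x xI; rewrite (@eq_integral _ _ _ mu _ (rearr a (EFin \o f))).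
      by apply: le_lt_trans (bnd _ xI) _; exact: ltry.
    move=> t; rewrite inE => tx; rewrite fineK// fin//.
    by have := xI; case=> _ xa; apply: oitvS tx => //; exact: ltW.
split; first exact: hu.
exists A, B; split.
- exact: prim_continuous.
- exact: prim_continuous.
- by move=> x y; exact: prim_homo.
- by move=> x y; apply: prim_inc => //; exact: weight_gt0.
- exact: prim0.
- exact: prim0.
- exact: A0.
- exact: B0.
- move=> y yI; rewrite -lee_fin -(prim_integral hu (ltW yI.2)).
  apply: le_trans (bnd _ yI); rewrite le_eqVlt; apply/orP; left; apply/eqP.
  apply: eq_integral => t; rewrite inE => ty; rewrite fineK// fin//.
  by apply: oitvS ty => //; exact: ltW yI.2.
Qed.

Lemma Qmod_level : Qmod phi a w f = Mmod phi a w (level_function a w f) /\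
  Mmod phi a w (level_function a w f) = wint phi a w (level_function a w f).
Proof.
have [fin [hu [A [B FW]]]] := Qclass_growth.
pose f0 := level_density a w f.
have w_gt0 := weight_gt0.
have phi_nd : monotone_on_nneg phi by move=> x y; exact: orlicz_homo.
have phi_ge0 x : (0 <= x)%R -> (0 <= phi x)%R by exact: orlicz_ge0.
have f0_ge0 t : oitv 0 a t -> (0 <= f0 t)%R by exact: (level_density_ge0 w_gt0 FW).
have f0_anti := level_density_anti ia w_gt0 FW.
have mI := measurable_oitv 0 a.
have mf0 : measurable_fun (oitv 0 a : set (measurableTypeR R)) (EFin \o f0).
  exact: (measurable_level_density ia w_gt0 FW).
pose N := jumps a u `|` jumps a w.
have cN : countable N.
  by rewrite /N -bigcup2E; apply: bigcup_countable => // -[|[|n]] _ //=; exact: countable_jumps.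
have levE t : oitv 0 a t -> ~ N t -> level_function a w f t = (f0 t)%:E.
  by move=> tI /not_orP[nu nw]; exact: (level_functionE hu ia w_gt0 fin FW).
(* Wanted at every point, including the jumps, where [levE] says nothing. *)
have lev_ge0 t : oitv 0 a t -> 0 <= level_function a w f t.
  move=> tI; have [fl|nfl] := pselect (flat a w f t).
    by rewrite (level_function_flat hu ia fin FW fl)//; rewrite lee_fin; exact: f0_ge0.
  rewrite (level_function_nonflat hu ia fin FW tI nfl) lee_fin.
  by have [_ H _ _] := hu; exact: H.
have rearrE : rearr a (level_function a w f) = rearr a (EFin \o f0).
  exact: (rearr_ae cN).
have wint_eq (g1 g2 : R -> \bar R) (X : set R) : countable X ->
    measurable_fun (oitv 0 a : set (measurableTypeR R)) g1 ->
    (forall t, oitv 0 a t -> 0 <= g1 t) -> (forall t, oitv 0 a t -> 0 <= g2 t) ->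
    (forall t, oitv 0 a t -> ~ X t -> g1 t = g2 t) -> wint phi a w g1 = wint phi a w g2.
  move=> cX mg1 g10 g20 E; apply: (integral_eq_countable _ cX) => //.
  - exact: (measurable_wint ia).
  - by move=> t tI; apply: (wint_integrand_ge0 w_gt0) => //; exact: g10.
  - by move=> t tI; apply: (wint_integrand_ge0 w_gt0) => //; exact: g20.
  - by move=> t tI Xt; rewrite E.
have Mf0 : Mmod phi a w (EFin \o f0) = wint phi a w (EFin \o f0).
  symmetry; apply: (wint_eq _ _ _ (countable_jumps a f0)) => //.
  - by move=> t _; exact: rearr_ge0.
  - by move=> t tI nj; rewrite (rearr_antitone f0_ge0 f0_anti tI nj).
have ML : Mmod phi a w (level_function a w f) = wint phi a w (EFin \o f0).
  by rewrite /Mmod rearrE.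
have LW : wint phi a w (EFin \o f0) = wint phi a w (level_function a w f).
  by apply: (wint_eq _ _ _ cN) => // t tI Nt; rewrite levE.
split; last by rewrite ML.
rewrite ML; apply/eqP; rewrite eq_le; apply/andP; split; last first.
  apply: le_ereal_inf_tmp => _ [g [fg _] <-].
  exact: (wint_orlicz_le hu ia w_gt0 fin FW).
(* Finiteness of the modular is what places [f0] in the class, with [lambda = 1]; it then competes
   in the infimum. *)
have [->|Mfin] := eqVneq (wint phi a w (EFin \o f0)) +oo; first exact: leey.
apply: ereal_inf_lbound; exists f0 => //; split.
  move=> x xI; have [x0 xa] := xI; have S : oitv 0 x%:E `<=` oitv 0 a by apply: oitvS => //; exact: ltW.
  have hf0 := int_antitone_level_density hu ia w_gt0 FW.
  have -> : \int[mu]_(t in oitv 0 x%:E) rearr a (EFin \o f) t = (F x)%:E.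
    rewrite -(prim_integral hu (ltW xa)); apply: eq_integral => t; rewrite inE => /S tI.
    by rewrite fineK// fin.
  have <- : \int[mu]_(t in oitv 0 x%:E) (EFin \o f0) t =
      \int[mu]_(t in oitv 0 x%:E) rearr a (EFin \o f0) t.
    apply: (integral_eq_countable _ (countable_jumps a f0)).
    - exact: measurable_oitv.
    - exact: measurable_funS mf0.
    - by move=> t /S tI; rewrite lee_fin; exact: f0_ge0.
    - by move=> t _; exact: rearr_ge0.
    - by move=> t /S tI nj; rewrite (rearr_antitone f0_ge0 f0_anti tI nj).
  rewrite (prim_integral hf0 (ltW xa)) lee_fin.
  exact: (prim_le_level_density hu ia w_gt0 FW).
split; last first.
  exists 1%R; split => //.
  rewrite (_ : (fun x => (1 * f0 x)%:E) = EFin \o f0) ?Mf0 ?ltey//.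
  by apply/funext => x; rewrite mul1r.
have mf0R : measurable_fun (oitv 0 a : set (measurableTypeR R)) f0.
  by apply/measurable_EFinP.
(* [L0] asks for Lebesgue measurability, which Borel measurability implies. *)
move=> _ Y mY; apply: sub_caratheodory; exact: mf0R.
Qed.

End Main.

Local Open Scope ereal_scope.

Theorem proposition8p7 (R : realType) (a : \bar R) (phi w : R -> R)
    (ha : 0 < a) (hphi : orlicz phi) (hw : weight a w)
    (f : R -> R) (hf : Qclass phi a w f) :
  Qmod phi a w f = Mmod phi a w (level_function a w f) /\
  Mmod phi a w (level_function a w f) =
    \int[lebesgue_measure]_(t in oitv 0 a)
      (er_map phi (level_function a w f t * ((w t)^-1)%:E) * (w t)%:E).
Proof. exact: Qmod_level. Qed.
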